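(* The fractional optimal control problem of minimizing $J(u,z)=\frac12\|u-u_d\|_{L^2(\Omega)}^2+\frac{\alpha}{2}\|z\|_{L^2(\Omega)}^2$ over all pairs $(u,z)\in\tilde H^s(\Omega)\times\mathbb{Z}_{\mathrm{ad}}$ satisfying $\mathcal{A}(u,v)=\langle f+z,v\rangle$ for all $v\in\tilde H^s(\Omega)$ has a unique solution $(\bar u,\bar z)\in\tilde H^s(\Omega)\times\mathbb{Z}_{\mathrm{ad}}$.
   Context: Let $n\ge 1$, let $\Omega\subset\mathbb{R}^n$ be a bounded open domain with Lipschitz boundary satisfying the exterior ball condition, and let $s\in(0,1)$. The parameters $\alpha>0$ and $a,b\in\mathbb{R}$ with $a<b$ are fixed, $f\in H^{-s}(\Omega)$ is fixed, and $u_d\in L^2(\Omega)$ is the desired state. $\tilde H^s(\Omega)$ is the closure of $C_0^\infty(\Omega)$ in $H^s(\mathbb{R}^n)$, equivalently the restrictions to $\Omega$ of functions $v\in H^s(\mathbb{R}^n)$ with $\operatorname{supp} v\subset\overline\Omega$ (its elements are extended by zero outside $\Omega$); $H^{-s}(\Omega)$ is its dual and $\langle\cdot,\cdot\rangle$ the duality pairing. The bilinear form is $$\mathcal{A}(v,w)=\frac{C(n,s)}{2}\iint_{\mathbb{R}^n\times\mathbb{R}^n}\frac{(v(x)-v(y))(w(x)-w(y))}{|x-y|^{n+2s}}\,dx\,dy,\qquad C(n,s)=\frac{2^{2s}s\,\Gamma(s+\frac n2)}{\pi^{n/2}\Gamma(1-s)}.$$ The equation $\mathcal{A}(u,v)=\langle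 f+z,v\rangle$ for all $v\in\tilde H^s(\Omega)$ is the weak form of $(-\Delta)^su=f+z$ in $\Omega$, $u=0$ in $\mathbb{R}^n\setminus\overline\Omega$. The set of admissible controls is $\mathbb{Z}_{\mathrm{ad}}=\{w\in L^2(\Omega): a\le w(x)\le b \text{ for a.e. }x\in\Omega\}$. *)

(* Defs.v *)
From HB Require Import structures.
From mathcomp Require Import all_boot all_order all_algebra.
From mathcomp Require Import all_classical all_reals all_analysis.
Set Implicit Arguments.
Unset Strict Implicit.
Unset Printing Implicit Defensive.
Import Order.TTheory GRing.Theory Num.Theory.
Import numFieldNormedType.Exports.
Local Open Scope classical_set_scope.
Local Open Scope ring_scope.

(* R^n is 'rV[R]_n; its sigma-algebra is generated by the coordinates, i.e. it
   is the Borel sigma-algebra. *)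
Definition rV_display : measure_display. Proof. exact: default_measure_display. Qed.

Section rV_measurable.
Context (R : realType) (n : nat).

Definition rV_coord (i : 'I_n) (x : 'rV[R]_n) : measurableTypeR R := x ord0 i.

Let rV_set0 : g_sigma_preimage rV_coord set0.
Proof. exact: sigma_algebra0. Qed.

Let rV_setC A : g_sigma_preimage rV_coord A -> g_sigma_preimage rV_coord (~` A).
Proof. exact: sigma_algebraC. Qed.

Let rV_bigcup (F : (set 'rV[R]_n)^nat) :
  (forall i, g_sigma_preimage rV_coord (F i)) ->
  g_sigma_preimage rV_coord (\bigcup_i (F i)).
Proof. exact: sigma_algebra_bigcup. Qed.

HB.instance Definition _ := @isMeasurable.Build rV_display 'rV[R]_n
  (g_sigma_preimage rV_coord) rV_set0 rV_setC rV_bigcup.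

End rV_measurable.

Lemma measurable_rV_coord (R : realType) n (i : 'I_n) :
  measurable_fun [set: 'rV[R]_n] (rV_coord i).
Proof.
move=> _ Y mY; rewrite setTI; apply: sub_sigma_algebra => /=.
rewrite -bigcup_seq/=; exists i => /=; first by rewrite mem_index_enum.
by exists Y => //; rewrite setTI.
Qed.

Lemma measurable_fun_rVP (R : realType) n d (T : measurableType d)
    (f : T -> 'rV[R]_n) :
  (forall i, measurable_fun [set: T] (rV_coord i \o f)) ->
  measurable_fun [set: T] f.
Proof.
move=> mf _ A mA; rewrite setTI.
suff h : @measurable _ 'rV[R]_n `<=` [set B | measurable (f @^-1` B)] by exact: h.
apply: smallest_sub.
  split => /=.
  - by rewrite preimage_set0.
  - by move=> B mB; rewrite setTD -preimage_setC; exact: measurableC.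
  - by move=> F mF; rewrite preimage_bigcup; exact: bigcup_measurable.
move=> B; rewrite -bigcup_seq/= => -[i _ [C mC <-]].
by have := mf i measurableT C mC; rewrite !setTI.
Qed.

Section lebesgue_rV.
Context (R : realType).

Definition rV_cons n (p : measurableTypeR R * 'rV[R]_n) : 'rV[R]_n.+1 :=
  row_mx (const_mx p.1 : 'rV[R]_1) p.2.

Lemma rV_cons0 n p : @rV_cons n p ord0 ord0 = p.1.
Proof.
have := row_mxEl (const_mx p.1 : 'rV[R]_1) p.2 ord0 ord0.
by rewrite [RHS]mxE => <-; congr (fun_of_matrix _ _ _); exact: val_inj.
Qed.

Lemma rV_consS n p i : @rV_cons n p ord0 (lift ord0 i) = p.2 ord0 i.
Proof.
have <- := row_mxEr (const_mx p.1 : 'rV[R]_1) p.2 ord0 i.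
by congr (fun_of_matrix _ _ _); exact: val_inj.
Qed.

Lemma measurable_rV_cons n :
  measurable_fun [set: measurableTypeR R * 'rV[R]_n] (@rV_cons n).
Proof.
apply: measurable_fun_rVP => i.
have [->|[j ->]] : i = ord0 \/ exists j, i = lift ord0 j.
  by case: (unliftP ord0 i) => [j ->|->]; [right; exists j|left].
- rewrite (_ : _ \o _ = fst)//.
  by apply/funext => p /=; rewrite /rV_coord rV_cons0.
- rewrite (_ : _ \o _ = rV_coord j \o snd); last first.
    by apply/funext => p /=; rewrite /rV_coord rV_consS.
  by apply: measurableT_comp => //; exact: measurable_rV_coord.
Qed.

Section step.
Context (n : nat) (m : {sigma_finite_measure set 'rV[R]_n -> \bar R}).

Definition lebesgue_rV_succ : set 'rV[R]_n.+1 -> \bar R :=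
  pushforward (@lebesgue_measure R \x m)%E (@rV_cons n).

Let mX (A : set 'rV[R]_n.+1) :
  measurable A -> measurable (@rV_cons n @^-1` A).
Proof. by move=> mA; rewrite -[X in measurable X]setTI; exact: measurable_rV_cons. Qed.

Let succ0 : lebesgue_rV_succ set0 = 0%E.
Proof. by rewrite /lebesgue_rV_succ /pushforward preimage_set0 measure0. Qed.

Let succ_ge0 A : (0 <= lebesgue_rV_succ A)%E.
Proof. by rewrite /lebesgue_rV_succ /pushforward; exact: measure_ge0. Qed.

Let succ_sigma_additive : semi_sigma_additive lebesgue_rV_succ.
Proof.
move=> F mF tF mUF; rewrite /lebesgue_rV_succ /pushforward preimage_bigcup.
apply: measure_semi_sigma_additive => [k||]; first exact: mX.
- apply/trivIsetP => /= i j _ _ ij; rewrite -preimage_setI.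
  by move/trivIsetP : tF => /(_ _ _ _ _ ij) ->//; rewrite preimage_set0.
- by rewrite -preimage_bigcup; exact: mX.
Qed.

HB.instance Definition _ := isMeasure.Build _ _ _
  lebesgue_rV_succ succ0 succ_ge0 succ_sigma_additive.

Let succ_sigma_finite : sigma_finite setT lebesgue_rV_succ.
Proof.
have /sigma_finiteP[A [UA ndA Aoo]] := sigma_finiteT (@lebesgue_measure R).
have /sigma_finiteP[B [UB ndB Boo]] := sigma_finiteT m.
pose p (x : 'rV[R]_n.+1) : measurableTypeR R * 'rV[R]_n :=
  (rV_coord ord0 x, \row_i x ord0 (lift ord0 i)).
have pK : cancel (@rV_cons n) p.
  move=> [t x]; congr pair; first by rewrite /rV_coord rV_cons0.
  by apply/rowP => i; rewrite mxE rV_consS.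
have mp : measurable_fun setT p.
  apply/measurable_fun_pair; first exact: measurable_rV_coord.
  apply: measurable_fun_rVP => i.
  rewrite (_ : _ \o _ = rV_coord (lift ord0 i)); first exact: measurable_rV_coord.
  by apply/funext => x /=; rewrite /rV_coord mxE.
exists (fun k => p @^-1` (A k `*` B k)) => [|k].
  rewrite -preimage_bigcup (_ : \bigcup_i _ = setT) ?preimage_setT//.
  rewrite -setXTT UA UB predeqE => -[x y]; split=> [[i _ []/= ? ?]|].
    by split; exists i.
  move=> [/= [i _ Aix] [j _ Bjy]]; exists (maxn i j) => //; split.
  - by move: x Aix; exact/subsetPset/ndA/leq_maxl.
  - by move: y Bjy; exact/subsetPset/ndB/leq_maxr.
have [mA Akoo] := Aoo k; have [mB Bkoo] := Boo k; split.
  by rewrite -[X in measurable X]setTI; apply: mp => //; exact: measurableX.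
rewrite /lebesgue_rV_succ /pushforward -comp_preimage.
rewrite (_ : p \o _ = id); last by apply/funext => x /=; rewrite pK.
by rewrite preimage_id product_measure1E// lte_mul_pinfty// ge0_fin_numE.
Qed.

HB.instance Definition _ := Measure_isSigmaFinite.Build _ _ _
  lebesgue_rV_succ succ_sigma_finite.

End step.

(* Lebesgue measure on R^n as an iterated product; R^0 is a one-point space. *)
Fixpoint lebesgue_rV n : {sigma_finite_measure set 'rV[R]_n -> \bar R} :=
  match n with
  | 0 => @dirac _ 'rV[R]_0 0 R
  | n'.+1 => lebesgue_rV_succ (lebesgue_rV n')
  end.

Lemma lebesgue_rV_box n (A : 'I_n -> set (measurableTypeR R)) :
  (forall i, measurable (A i)) ->
  lebesgue_rV n [set x : 'rV[R]_n | forall i, A i (x ord0 i)] =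
  (\prod_(i < n) lebesgue_measure (A i))%E.
Proof.
elim: n A => [|n IH] A mA.
  by rewrite big_ord0 /= diracE mem_set// => -[].
rewrite big_ord_recl -(IH (fun i => A (lift ord0 i)))//=.
rewrite /lebesgue_rV_succ /pushforward.
rewrite [X in (_ \x _)%E X](_ : _ =
  A ord0 `*` [set x : 'rV[R]_n | forall i : 'I_n, A (lift ord0 i) (x ord0 i)]).
  rewrite product_measure1E//.
  rewrite (_ : [set x | _] = \bigcap_(i in setT) (rV_coord i @^-1` A (lift ord0 i))).
    apply: fin_bigcap_measurable => // i _; rewrite -[X in measurable X]setTI.
    exact: measurable_rV_coord.
  by apply/seteqP; split => x /= h i; [move=> _|]; exact: h.
apply/seteqP; split => -[t x] /=.
  move=> h; split; first by have := h ord0; rewrite rV_cons0.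
  by move=> i; have := h (lift ord0 i); rewrite rV_consS.
move=> [h0 hS] i; case: (unliftP ord0 i) => [j ->|->].
  by rewrite rV_consS; exact: hS.
by rewrite rV_cons0.
Qed.

End lebesgue_rV.

Section geometry.
Context (R : realType).

(* The library norm `|x| on 'rV[R]_n is the maximum norm. *)
Definition enorm n (x : 'rV[R]_n) : R := Num.sqrt (\sum_(i < n) x ord0 i ^+ 2).

Context (n : nat).
Implicit Types Omega : set 'rV[R]_n.

Definition eball (c : 'rV[R]_n) (r : R) : set 'rV[R]_n :=
  [set x | enorm (x - c) < r].

Definition boundary Omega := closure Omega `&` closure (~` Omega).

Definition bounded_domain Omega :=
  [/\ open Omega, connected Omega, Omega !=set0 & bounded_set Omega].

(* In suitable orthonormal coordinates x *m Q, and locally at each boundary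
   point, Omega lies above the graph of a Lipschitz function gamma of all the
   coordinates but the i-th one. *)
Definition lipschitz_boundary Omega :=
  forall x0, boundary Omega x0 ->
  exists r : R, exists Q : 'M[R]_n, exists i : 'I_n,
  exists gamma : 'rV[R]_n.-1 -> R, exists L : R,
  [/\ 0 < r, Q *m Q^T = 1%:M,
      forall y y', `|gamma y - gamma y'| <= L * enorm (y - y') &
      eball x0 r `&` Omega =
      eball x0 r `&` [set x | gamma (col' i (x *m Q)) < (x *m Q) ord0 i]].

(* The radius may depend on the boundary point. *)
Definition exterior_ball_condition Omega :=
  forall x0, boundary Omega x0 ->
  exists c : 'rV[R]_n, exists r : R,
  [/\ 0 < r, eball c r `&` Omega = set0 & enorm (x0 - c) = r].

End geometry.

Section fractional_sobolev.
Context (R : realType) (n : nat).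
Notation mu := (lebesgue_rV R n).
Implicit Types (Omega : set 'rV[R]_n) (s : R) (v w z : 'rV[R]_n -> R).

(* Elements of L^2 and of the Sobolev spaces are represented by functions,
   identified when they agree almost everywhere; v \_ Omega extends by zero. *)
Definition inL2 Omega v := v \_ Omega \in Lfun mu 2%:E.

Definition L2norm Omega v : R := fine ('N[mu]_2%:E[EFin \o (v \_ Omega)])%E.

(* On the diagonal, which is negligible, the value is 0. *)
Definition frac_kernel s (p : 'rV[R]_n * 'rV[R]_n) : R :=
  (enorm (p.1 - p.2) `^ (n%:R + 2 * s))^-1.

Definition gagliardo_sqr s v : \bar R :=
  (\int[(mu \x mu)%E]_p ((v p.1 - v p.2) ^+ 2 * frac_kernel s p)%:E)%E.

Definition Hs_norm s v : \bar R :=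
  sqrte ('N[mu]_2%:E[EFin \o v] ^+ 2 + gagliardo_sqr s v)%E.

Definition inHs s v := v \in Lfun mu 2%:E /\ (gagliardo_sqr s v < +oo)%E.

Definition iter_partial (l : seq 'I_n) v : 'rV[R]_n -> R :=
  foldr (fun i g => 'D_(delta_mx ord0 i) g) v l.

Definition smooth v := forall l : seq 'I_n,
  continuous (iter_partial l v) /\
  forall x i, derivable (iter_partial l v) x (delta_mx ord0 i).

Definition tsupport v := closure [set x | v x != 0].

Definition test_function Omega v :=
  [/\ smooth v, compact (tsupport v) & tsupport v `<=` Omega].

(* \tilde H^s(Omega): the closure of the test functions in H^s(R^n). *)
Definition in_tildeHs Omega s v :=
  inHs s v /\ forall e : R, 0 < e ->
  exists2 phi, test_function Omega phi & (Hs_norm s (v \- phi)%R < e%:E)%E.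

(* H^{-s}(Omega), as the dual of \tilde H^s(Omega): only the values of f on
   \tilde H^s(Omega) matter. *)
Definition in_dual Omega s (f : ('rV[R]_n -> R) -> R) :=
  (forall (c : R) v w, in_tildeHs Omega s v -> in_tildeHs Omega s w ->
     f (fun x => c * v x + w x) = c * f v + f w) /\
  exists C : R, forall v, in_tildeHs Omega s v ->
    (`|f v|%:E <= C%:E * Hs_norm s v)%E.

Definition Gamma (x : R) : R :=
  (\int[lebesgue_measure]_(t in `]0%R, +oo[) (t `^ (x - 1) * expR (- t)))%R.

Definition frac_const s : R :=
  2 `^ (2 * s) * s * Gamma (s + n%:R / 2) / (pi `^ (n%:R / 2) * Gamma (1 - s)).

Definition frac_form s v w : R :=
  frac_const s / 2 *
  (\int[(mu \x mu)%E]_p ((v p.1 - v p.2) * (w p.1 - w p.2) * frac_kernel s p))%R.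

Definition admissible_control Omega (a b : R) z :=
  inL2 Omega z /\ {ae mu, forall x, Omega x -> a <= z x <= b}.

Definition state_equation Omega s f u z := forall v, in_tildeHs Omega s v ->
  frac_form s u v = f v + (\int[mu]_(x in Omega) (z x * v x))%R.

Definition cost Omega (alpha : R) ud u z : R :=
  2^-1 * L2norm Omega (u \- ud) ^+ 2 + alpha / 2 * L2norm Omega z ^+ 2.

Definition feasible Omega s (a b : R) f u z :=
  [/\ in_tildeHs Omega s u, admissible_control Omega a b z
    & state_equation Omega s f u z].

Definition optimal_pair Omega s alpha (a b : R) f ud u z :=
  feasible Omega s a b f u z /\
  forall u' z', feasible Omega s a b f u' z' ->
    cost Omega alpha ud u z <= cost Omega alpha ud u' z'.

End fractional_sobolev.

(* Main.v *)
(* Direct method, used twice. A functional J on a convex set whose midpoint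
   convexity gap controls a complete distance has a minimizer, because a
   minimizing sequence is Cauchy. Applied to
     v |-> kappa/2 [v]^2 - f(v) - <z,v>,
   whose coercivity on \tilde H^s is a Poincare inequality, this solves the state
   equation, so that feasible pairs exist. Applied to the cost, whose gap is
   1/8 ||u-u'||^2 + alpha/8 ||z-z'||^2, it gives the optimal pair: the controls of
   a minimizing sequence converge in L^2, the states then converge in H^s by the
   state equation, and admissibility and the state equation pass to the limit.
   The same gap, evaluated at two optimal pairs, gives uniqueness: the states
   agree a.e. on Omega, and elements of \tilde H^s vanish a.e. outside. *)
Require Import Defs.
From mathcomp Require Import all_boot all_order all_algebra.
From mathcomp Require Import all_classical all_reals all_analysis.
From mathcomp Require Import measurable_realfun ring lra.
Set Implicit Arguments.
Unset Strict Implicit.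
Unset Printing Implicit Defensive.
Import Order.TTheory GRing.Theory Num.Theory.
Import numFieldNormedType.Exports.
Local Open Scope classical_set_scope.
Local Open Scope ring_scope.

(** All Hilbert-space arguments run through one pairing [ip], taken over an arbitrary measure. It is
    used on R^n and, through [gdiff], on R^n x R^n, where the Gagliardo form becomes an inner
    product; Cauchy-Schwarz, the parallelogram identity and Fatou are thus proved once for both.
    Minimizing sequences carry the explicit rate [8^-k], fast enough for the whole sequence to
    converge almost everywhere, so neither subsequences nor weak compactness enter. Pointwise
    convergence is what allows a limit to be followed through [gdiff], where Fatou bounds its
    energy, and through the pointwise bounds on the controls. The form is coercive only if
    [frac_const] is positive, which is why the Gamma integrals are studied. *)

Lemma cvg_divX0 (R : realType) (M : R) : M / 8 ^+ k @[k --> \oo] --> (0 : R).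
Proof.
have := @cvg_geometric R M 8^-1.
rewrite ger0_norm ?invr_ge0// invf_lt1// ltr1n => /(_ isT).
by apply: cvg_trans; apply: near_eq_cvg; apply: nearW => k; rewrite /= exprVn.
Qed.

Lemma cvg0_squeeze (R : realType) (M : R) (u : nat -> R) :
  (forall k, 0 <= u k <= M / 8 ^+ k) -> u @ \oo --> (0 : R).
Proof.
move=> uM; apply: (squeeze_cvgr _ (cvg_cst 0) (cvg_divX0 M)).
exact: nearW.
Qed.

Lemma cvg_sqrt0 (R : realType) (u : nat -> R) : u @ \oo --> (0 : R) ->
  Num.sqrt (u k) @[k --> \oo] --> (0 : R).
Proof.
move=> cu; rewrite -[X in _ --> X]sqrtr0; apply: continuous_cvg => //.
exact: sqrt_continuous.
Qed.

(** Serves twice: for Cauchy-Schwarz, and with [a = 0] as the first-order condition at a minimizer,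
    where it forces [b = 0]. *)
Lemma quadratic_discriminant (R : realFieldType) (a b c : R) : 0 <= c ->
  (forall t, 0 <= a + 2 * t * b + t ^+ 2 * c) -> b ^+ 2 <= a * c.
Proof.
rewrite le_eqVlt => /predU1P[<- h|c_gt0 h].
  have [->|b0] := eqVneq b 0; first by rewrite expr0n mulr0.
  (* With [c = 0] the expression is affine in [t], and this [t] gives it the value [-1]. *)
  have := h (- (a + 1) / (2 * b)); rewrite mulr0 addr0.
  have -> : 2 * (- (a + 1) / (2 * b)) * b = - (a + 1) by field.
  by lra.
have := h (- b / c).
have -> : a + 2 * (- b / c) * b + (- b / c) ^+ 2 * c = (a * c - b ^+ 2) / c.
  by field; rewrite gt_eqF.
by rewrite pmulr_lge0 ?invr_gt0// subr_ge0.
Qed.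

(** * Square-integrable functions *)

Section inner_product.
Context d (T : measurableType d) (R : realType).
Variable nu : {measure set T -> \bar R}.
Implicit Types u v w : T -> R.

Local Notation L2 := (Lfun nu 2%:E).

(** Real-valued through [fine], hence meaningless when the integral is infinite; the algebraic rules
    are therefore stated on [L2], where products are integrable. *)
Definition ip v w : R := (\int[nu]_x (v x * w x))%R.

Definition L2nm v : R := Num.sqrt (ip v v).

Lemma L2_measurable v : v \in L2 -> measurable_fun setT v.
Proof. by rewrite inE => /andP[/[!inE]]. Qed.

Lemma L2_integrableM v w : v \in L2 -> w \in L2 ->
  nu.-integrable setT (EFin \o (fun x => v x * w x)).
Proof. by move=> v2 w2; apply/Lfun1_integrable; exact: Lfun2_mul_Lfun1. Qed.

Lemma Lnorm2_sqr v :
  ('N[nu]_2%:E[EFin \o v] ^+ 2 = \int[nu]_x (v x ^+ 2)%:E)%E.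
Proof.
have sqrE (x : \bar R) : (0 <= x -> x ^+ 2 = x `^ 2)%E.
  case: x => [r|_|//]; last by rewrite poweRyr ?pnatr_eq0// expe2 mulyy.
  by rewrite lee_fin => r0; rewrite poweR_EFin powR_mulrn// -EFinM expr2.
rewrite sqrE ?Lnorm_ge0// poweR_Lnorm//.
by apply: eq_integral => x _; rewrite /= powR_mulrn// real_normK ?num_real.
Qed.

Lemma L2P v : v \in L2 <->
  measurable_fun setT v /\ (\int[nu]_x (v x ^+ 2)%:E < +oo)%E.
Proof.
rewrite -Lnorm2_sqr; split=> [v2|[mv iv]].
  split; first exact: L2_measurable.
  move: v2; rewrite inE => /andP[_ /[!inE]] /= v2.
  by rewrite lte_mul_pinfty ?Lnorm_ge0// ge0_fin_numE ?Lnorm_ge0.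
rewrite inE; apply/andP; split; rewrite inE//= /finite_norm.
rewrite ltNge leye_eq; apply/negP => /eqP h.
by move: iv; rewrite h.
Qed.

Let submod : submod_closed L2 .
Proof. by apply: Lfun_submod_closed; rewrite lee_fin ler1n. Qed.

Lemma L2lin (c : R) v w : v \in L2 -> w \in L2 ->
  (fun x => c * v x + w x) \in L2.
Proof. by move=> v2 w2; apply: submod.2. Qed.

Lemma L20 : (fun=> 0) \in L2.
Proof. exact: submod.1. Qed.

Lemma L2Z (c : R) v : v \in L2 -> (fun x => c * v x) \in L2.
Proof.
by move=> v2; have := L2lin c v2 L20; under eq_fun do rewrite addr0.
Qed.

Lemma L2D v w : v \in L2 -> w \in L2 -> (fun x => v x + w x) \in L2.
Proof.
by move=> v2 w2; have := L2lin 1 v2 w2; under eq_fun do rewrite mul1r.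
Qed.

Lemma L2B v w : v \in L2 -> w \in L2 -> (fun x => v x - w x) \in L2.
Proof.
move=> v2 w2; have := L2lin (-1) w2 v2.
by under eq_fun do rewrite mulN1r addrC.
Qed.

Lemma ip_sqr v : v \in L2 -> (ip v v)%:E = (\int[nu]_x (v x ^+ 2)%:E)%E.
Proof.
move=> v2; rewrite /ip /Rintegral fineK.
  by apply: eq_integral => x _; rewrite expr2.
by apply: integrable_fin_num => //; exact: L2_integrableM.
Qed.

Lemma ipC v w : ip v w = ip w v.
Proof. by apply: eq_Rintegral => x _; rewrite mulrC. Qed.

Lemma ip_ge0 v : 0 <= ip v v.
Proof. by apply: Rintegral_ge0 => x _; rewrite -expr2 sqr_ge0. Qed.

Lemma ip_linl (c : R) u v w : u \in L2 -> v \in L2 -> w \in L2 ->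
  ip (fun x => c * u x + v x) w = c * ip u w + ip v w.
Proof.
move=> u2 v2 w2; rewrite /ip.
under eq_Rintegral do rewrite mulrDl -mulrA.
rewrite RintegralD// ?RintegralZl//; try exact: L2_integrableM.
by under eq_fun do rewrite mulrA; exact: (L2_integrableM (L2Z c u2) w2).
Qed.

Lemma ip0l w : ip (fun=> 0) w = 0.
Proof.
by rewrite /ip; under eq_Rintegral do rewrite mul0r; rewrite Rintegral_cst ?mul0r.
Qed.

Lemma ipBl u v w : u \in L2 -> v \in L2 -> w \in L2 ->
  ip (fun x => u x - v x) w = ip u w - ip v w.
Proof.
move=> u2 v2 w2; have := ip_linl (-1) v2 u2 w2.
by rewrite mulN1r addrC => <-; congr ip; apply/funext => x; rewrite mulN1r addrC.
Qed.

Lemma ipBr u v w : u \in L2 -> v \in L2 -> w \in L2 ->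
  ip w (fun x => u x - v x) = ip w u - ip w v.
Proof. by move=> u2 v2 w2; rewrite ipC ipBl// !(ipC w). Qed.

Lemma ip_sqrD (c : R) v w : v \in L2 -> w \in L2 ->
  ip (fun x => c * v x + w x) (fun x => c * v x + w x) =
  c ^+ 2 * ip v v + 2 * c * ip v w + ip w w.
Proof.
move=> v2 w2; have vw := L2lin c v2 w2.
rewrite ip_linl// (ipC v) (ipC w) !ip_linl// (ipC w v); ring.
Qed.

Lemma ip_sqrB v w : v \in L2 -> w \in L2 ->
  ip (fun x => v x - w x) (fun x => v x - w x) =
  ip v v - 2 * ip v w + ip w w.
Proof.
move=> v2 w2; have := ip_sqrD (-1) w2 v2.
under eq_fun do rewrite mulN1r addrC.
by rewrite (ipC w v) => ->; ring.
Qed.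

Lemma ip_lin_le (c : R) v w :
  v \in L2 -> w \in L2 ->
  ip (fun x => c * v x + w x) (fun x => c * v x + w x) <=
  2 * c ^+ 2 * ip v v + 2 * ip w w.
Proof.
move=> v2 w2; have := ip_ge0 (fun x => - c * v x + w x).
rewrite !ip_sqrD// sqrrN; lra.
Qed.

Lemma ip_sqrBC v w :
  ip (fun x => v x - w x) (fun x => v x - w x) =
  ip (fun x => w x - v x) (fun x => w x - v x).
Proof. by apply: eq_Rintegral => x _; rewrite -!expr2 -sqrrN opprB. Qed.

(** Parallelogram identity. The midpoint is written in the form [c * v + w], to which the closure
    lemmas apply directly. *)
Lemma ip_mid v w :
  v \in L2 -> w \in L2 ->
  let m := fun x => 2^-1 * (v x - w x) + w x in
  ip m m + 4^-1 * ip (fun x => v x - w x) (fun x => v x - w x) =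
  (ip v v + ip w w) / 2.
Proof.
move=> v2 w2 m; by rewrite /m ip_sqrD ?L2B// ip_sqrB// ipBl//; field.
Qed.

Lemma cauchy_schwarz v w : v \in L2 -> w \in L2 ->
  ip v w ^+ 2 <= ip v v * ip w w.
Proof.
move=> v2 w2; apply: quadratic_discriminant; first exact: ip_ge0.
move=> t; have := ip_ge0 (fun x => t * w x + v x).
rewrite ip_sqrD// (ipC w v); congr (0 <= _); ring.
Qed.

Lemma ler_norm_ip v w : v \in L2 -> w \in L2 ->
  `|ip v w| <= L2nm v * L2nm w.
Proof.
move=> v2 w2; rewrite -sqrtrM ?ip_ge0// -sqrtr_sqr ler_wsqrtr//.
exact: cauchy_schwarz.
Qed.

Lemma ip_cvg (x y : nat -> T -> R) (x0 y0 : T -> R) :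
  (forall k, x k \in L2) -> (forall k, y k \in L2) -> x0 \in L2 -> y0 \in L2 ->
  ip (fun t => x k t - x0 t) (fun t => x k t - x0 t) @[k --> \oo] --> (0 : R) ->
  ip (fun t => y k t - y0 t) (fun t => y k t - y0 t) @[k --> \oo] --> (0 : R) ->
  ip (x k) (y k) @[k --> \oo] --> ip x0 y0.
Proof.
move=> x2 y2 x02 y02 cx cy.
pose X k := L2nm (fun t => x k t - x0 t); pose Y k := L2nm (fun t => y k t - y0 t).
have cX : X @ \oo --> (0 : R) by exact: cvg_sqrt0.
have cY : Y @ \oo --> (0 : R) by exact: cvg_sqrt0.
have cB : X k * Y k + X k * L2nm y0 + L2nm x0 * Y k @[k --> \oo] --> (0 : R).
  rewrite [X in _ --> X](_ : 0 = 0 * 0 + 0 * L2nm y0 + L2nm x0 * 0).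
    apply: cvgD; last by apply: cvgM => //; exact: cvg_cst.
    by apply: cvgD; apply: cvgM => //; exact: cvg_cst.
  by rewrite !mulr0 mul0r !addr0.
apply/subr_cvg0; apply: norm_cvg0.
apply: (squeeze_cvgr _ (cvg_cst 0) cB); apply: nearW => k; rewrite normr_ge0/=.
have xk := L2B (x2 k) x02; have yk := L2B (y2 k) y02.
(* Each of the three terms has a factor tending to zero; Cauchy-Schwarz bounds them by the terms of
   [cB]. *)
have -> : ip (x k) (y k) - ip x0 y0 =
    ip (fun t => x k t - x0 t) (fun t => y k t - y0 t) +
    ip (fun t => x k t - x0 t) y0 + ip x0 (fun t => y k t - y0 t).
  by rewrite !(ipBl (x2 k) x02)// !ipBr//; ring.
rewrite (le_trans (ler_normD _ _))// lerD ?ler_norm_ip//.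
by rewrite (le_trans (ler_normD _ _))// lerD ?ler_norm_ip.
Qed.

(** Turns Cauchy bounds into bounds on the distance to a pointwise limit, on R^n and on the product
    space alike. *)
Lemma L2_fatou (w : nat -> T -> R) (w0 : T -> R) (c : R) :
  measurable_fun setT w0 -> (forall m, w m \in L2) ->
  (forall m, ip (w m) (w m) <= c) ->
  {ae nu, forall x, w m x @[m --> \oo] --> w0 x} ->
  w0 \in L2 /\ ip w0 w0 <= c.
Proof.
move=> mw0 w2 wc cw.
have mw m : measurable_fun setT (w m) by exact: L2_measurable.
have int_le : (\int[nu]_x (w0 x ^+ 2)%:E <= c%:E)%E.
  pose F (m : nat) (x : T) : \bar R := (w m x ^+ 2)%:E.
  have mF m : measurable_fun setT (F m).
    by apply/measurable_EFinP; exact: measurable_funX.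
  have F0 m x : setT x -> (0 <= F m x)%E by rewrite lee_fin sqr_ge0.
  (* Almost everywhere the lower limit of the squares is [w0 ^ 2], which brings the integral into
     the form of Fatou's lemma. *)
  rewrite (ae_eq_integral (fun x => limn_einf (F^~ x))) //.
  - apply: le_trans (fatou nu measurableT mF F0) _; rewrite limn_einf_lim.
    apply: lime_le; first exact: is_cvg_einfs.
    apply: nearW => m; apply: le_trans (_ : \int[nu]_x F m x <= _)%E.
      by apply: ereal_inf_lbound; exists m => /=.
    by rewrite -ip_sqr ?lee_fin.
  - by apply/measurable_EFinP; exact: measurable_funX.
  - apply: (eq_measurable_fun (fun x => - limn_esup (fun m => - F m x))%E).
      by move=> x _; rewrite limn_esupN oppeK.
    apply: measurableT_comp => //; apply: measurable_fun_limn_esup => m.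
    exact: measurableT_comp.
  - apply: filterS cw => x cwx _.
    have /cvg_limn_einf_sup[] // : F^~ x @ \oo --> (w0 x ^+ 2)%:E.
    by apply: cvg_EFin; [exact: nearW|rewrite /= expr2; apply: cvgM].
have w02 : w0 \in L2 by apply/L2P; split => //; exact: le_lt_trans int_le (ltry _).
by split=> //; rewrite -lee_fin ip_sqr.
Qed.

(* [\sum_k 4^k (v_{k+1} - v_k)^2] has a finite integral, hence is finite a.e., and
   the increments decay geometrically wherever it is. *)
Lemma L2_fast_cauchy_ae_cvg (v : nat -> T -> R) (M : R) :
  (forall k, v k \in L2) ->
  (forall k, ip (fun x => v k.+1 x - v k x) (fun x => v k.+1 x - v k x) <=
     M / 8 ^+ k) ->
  {ae nu, forall x, cvgn (v^~ x)}.
Proof.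
move=> v2 vM; pose dv k x := v k.+1 x - v k x.
have dv2 k : dv k \in L2 by exact: L2B.
have M0 : 0 <= M by have := le_trans (ip_ge0 _) (vM 0%N); rewrite expr0 divr1.
pose F k x : \bar R := (4 ^+ k * dv k x ^+ 2)%:E.
have F0 k x : (0 <= F k x)%E by rewrite lee_fin mulr_ge0 ?sqr_ge0.
have mF k : measurable_fun setT (F k).
  apply/measurable_EFinP; apply: measurable_funM => //.
  by apply: measurable_funX; exact: L2_measurable.
pose g x : \bar R := (\sum_(k <oo) F k x)%E.
have g0 x : (0 <= g x)%E by exact: nneseries_ge0.
have int_g : nu.-integrable setT g.
  apply/integrableP; split; first exact: ge0_emeasurable_sum.
  under eq_integral do rewrite gee0_abs//.
  rewrite integral_nneseries//; apply: (@le_lt_trans _ _ (2 * M)%:E); last first.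
    exact: ltry.
  apply: lime_le.
    by apply: is_cvg_nneseries => k _ _; exact: integral_ge0.
  apply: nearW => n.
  (* The weight [4^k] against the rate [M / 8^k] leaves [M / 2^k], with total at most [2 M]. *)
  apply: (@le_trans _ _ (\sum_(0 <= k < n) (M / 2 ^+ k)%:E)%E).
    apply: lee_sum => k _.
    rewrite (_ : (\int[nu]_x F k x = (4 ^+ k)%:E * (ip (dv k) (dv k))%:E)%E).
      rewrite lee_fin (le_trans (ler_wpM2l _ (vM k)))//.
      rewrite (_ : 8 = 4 * 2)// ?exprMn ?invfM; last by rewrite -natrM.
      by rewrite mulrCA [4 ^+ k * _]mulrA mulfV ?mul1r// expf_neq0.
    rewrite ip_sqr// -ge0_integralZl// => [|x _]; last by rewrite lee_fin sqr_ge0.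
    by apply/measurable_EFinP; apply: measurable_funX; exact: L2_measurable.
  rewrite sumEFin lee_fin.
  suff -> : \sum_(0 <= k < n) (M / 2 ^+ k) = 2 * M - 2 * M / 2 ^+ n.
    by rewrite gerBl divr_ge0 ?mulr_ge0.
  elim: n => [|n IH]; first by rewrite big_geq// expr0 divr1 subrr.
  by rewrite big_nat_recr//= IH exprS; field.
apply: filterS (integrable_ae measurableT int_g) => x /(_ I) gx.
have dvx k : `|dv k x| <= Num.sqrt (fine (g x)) / 2 ^+ k.
  have : (F k x <= g x)%E.
    rewrite /g (nneseriesD1 (n := k))//.
    by rewrite leeDl// nneseries_ge0// => *; exact: F0.
  rewrite -{1}(fineK gx) lee_fin => h.
  rewrite -sqrtr_sqr -[_ / _]ger0_norm ?divr_ge0// -sqrtr_sqr ler_wsqrtr//.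
  rewrite expr_div_n sqr_sqrtr ?fine_ge0// -exprM mulnC exprM.
  rewrite (_ : 2 ^+ 2 = 4 :> R); last by rewrite -natrX.
  by rewrite ler_pdivlMr ?exprn_gt0// mulrC.
have : cvgn (series (dv^~ x)).
  apply: normed_cvg; apply: (@series_le_cvg _ _
    (geometric (Num.sqrt (fine (g x))) 2^-1)) => // [k|k|k|].
  - exact: normr_ge0.
  - by rewrite /geometric /= mulr_ge0.
  - by rewrite /geometric /= exprVn.
  - apply: is_cvg_geometric_series.
    by rewrite ger0_norm ?invr_ge0// invf_lt1// ltr1n.
move=> /cvg_ex[l cl]; apply/cvg_ex; exists (v 0%N x + l).
rewrite (_ : v^~ x = fun n => v 0%N x + series (dv^~ x) n).
  by apply: cvgD => //; exact: cvg_cst.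
apply/funext => n; rewrite /series /= telescope_sumr// addrC subrK//.
Qed.

(** Fatou along [v (m + k) - v k], with [k] fixed and [m] growing, transfers the Cauchy bound to the
    limit with the same constant. *)
Lemma L2_complete (v : nat -> T -> R) (M : R) :
  (forall k, v k \in L2) ->
  (forall k m, (k <= m)%N ->
     ip (fun x => v m x - v k x) (fun x => v m x - v k x) <= M / 8 ^+ k) ->
  exists v0, [/\ v0 \in L2, {ae nu, forall x, v k x @[k --> \oo] --> v0 x} &
    forall k, ip (fun x => v k x - v0 x) (fun x => v k x - v0 x) <= M / 8 ^+ k].
Proof.
move=> v2 vM.
(* An upper limit is measurable and defined everywhere; it is the pointwise limit wherever that
   exists. *)
pose v0 x : R := fine (limn_esup (fun k => (v k x)%:E)).
have mv0 : measurable_fun setT v0.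
  apply: (measurableT_comp (fine_measurable measurableT)).
  apply: measurable_fun_limn_esup => k.
  by apply/measurable_EFinP; exact: L2_measurable.
have vcvg : {ae nu, forall x, v k x @[k --> \oo] --> v0 x}.
  have := L2_fast_cauchy_ae_cvg v2 (fun k => vM k k.+1 (leqnSn k)).
  apply: filterS => x /cvg_ex[l cl].
  have cE : (v k x)%:E @[k --> \oo] --> l%:E by apply: cvg_EFin => //; exact: nearW.
  by rewrite /v0 (cvg_limn_einf_sup cE).2.
have key k : (fun x => v0 x - v k x) \in L2 /\
    ip (fun x => v0 x - v k x) (fun x => v0 x - v k x) <= M / 8 ^+ k.
  apply: (L2_fatou (w := fun m x => v (m + k)%N x - v k x)).
  - by apply: measurable_funB => //; exact: L2_measurable.
  - by move=> m; exact: L2B.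
  - by move=> m; apply: vM; rewrite leq_addl.
  - apply: filterS vcvg => x cx; apply: cvgB; last exact: cvg_cst.
    by rewrite (cvg_shiftn k (v^~ x)).
exists v0; split=> //.
  have := L2D (key 0%N).1 (v2 0%N).
  by under eq_fun do rewrite subrK.
move=> k; have := (key k).2; congr (_ <= _).
by apply: eq_Rintegral => x _; rewrite -!expr2 -sqrrN opprB.
Qed.

End inner_product.

(** * Existence of minimizers *)

(* [q] is a lower bound of the midpoint convexity gap; points with
   [J x_k < inf J + 8^-k] therefore satisfy [q (x_m) (x_k) <= 8^-k] for [k <= m]. *)
Lemma minimizer_exists (R : realType) (X : Type) (K : set X) (J : X -> R)
    (q : X -> X -> R) (lb : R) :
  K !=set0 -> (forall x, K x -> lb <= J x) ->
  (forall x y, K x -> K y ->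
     exists2 w, K w & J w + q x y <= (J x + J y) / 2) ->
  (forall x_ : nat -> X, (forall k, K (x_ k)) ->
     (forall k m, (k <= m)%N -> q (x_ m) (x_ k) <= 1 / 8 ^+ k) ->
     exists2 x, K x & J (x_ k) @[k --> \oo] --> J x) ->
  exists2 x, K x & forall y, K y -> J x <= J y.
Proof.
move=> [x0 Kx0] Jlb Jconv Kcomplete.
have JK0 : has_inf (J @` K).
  by split; [exists (J x0), x0|exists lb => _ [x Kx <-]; exact: Jlb].
pose i := inf (J @` K).
have iJ y : K y -> i <= J y by move=> Ky; apply: ge_inf; [exact: JK0.2|exists y].
have near_i k : exists x, K x /\ J x < i + 1 / 8 ^+ k.
  have k0 : 0 < (1 : R) / 8 ^+ k by rewrite divr_gt0// exprn_gt0.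
  by have [_ [x Kx <-] xlt] := inf_adherent k0 JK0; exists x.
have [x_ x_P] := choice near_i.
have [x Kx Jx] : exists2 x, K x & J (x_ k) @[k --> \oo] --> J x.
  apply: Kcomplete => [k|k m km]; first by have [] := x_P k.
  (* [J w] is at least the infimum, while the mean of the two values exceeds the infimum by less
     than [8^-k], since [8^-m <= 8^-k]. *)
  have [w Kw wle] := Jconv _ _ (x_P m).1 (x_P k).1.
  have := (x_P m).2; have := (x_P k).2; have := iJ _ Kw.
  have : (1 : R) / 8 ^+ m <= 1 / 8 ^+ k.
    by rewrite !div1r lef_pV2 ?posrE ?exprn_gt0// ler_weXn2l// ler1n.
  by lra.
exists x => // y /iJ; apply: le_trans.
have : i + 1 / 8 ^+ k @[k --> \oo] --> i.
  by rewrite -[X in _ --> X]addr0; apply: cvgD; [exact: cvg_cst|exact: cvg_divX0].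
move=> ik; apply: (ler_cvg_to Jx ik); apply: nearW => k; exact/ltW/(x_P k).2.
Qed.

(** * Positivity of the Gamma function *)

Section gamma_positive.
Context (R : realType).
Notation leb := (@lebesgue_measure R).

(** Exhausts the open half-line by compact intervals that avoid the possible singularity at [0], so
    that the fundamental theorem of calculus applies on each. *)
Lemma bigcup_itv_inv_nat :
  \bigcup_k `[k.+1%:R^-1 : R, k.+2%:R]%classic = `]0, +oo[%classic.
Proof.
apply/seteqP; split => t /=.
  move=> [k _] /=; rewrite !in_itv/= andbT => /andP[+ _].
  by apply: lt_le_trans; rewrite invr_gt0.
rewrite in_itv/= andbT => t0; have ti0 : 0 < t^-1 by rewrite invr_gt0.
have [k1 tk1] : exists k : nat, t <= k.+2%:R.
  exists (Num.truncn t); rewrite (le_trans (ltW (truncnS_gt t)))//.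
  by rewrite ler_nat.
have [k2 tk2] : exists k : nat, t^-1 <= k.+1%:R.
  by exists (Num.truncn t^-1); exact: ltW (truncnS_gt _).
exists (maxn k1 k2) => //=; rewrite in_itv/=; apply/andP; split.
  rewrite -[leRHS]invrK lef_pV2 ?posrE// (le_trans tk2)// ler_nat ltnS.
  exact: leq_maxr.
by rewrite (le_trans tk1)// ler_nat !ltnS leq_maxl.
Qed.

(** Monotone convergence along the exhausting intervals: on each one the integral is an increment of
    [F], hence at most [c]. *)
Lemma integral_bounded_primitive (f F : R -> R) (c : R) :
  measurable_fun setT f ->
  (forall t : R, 0 < t -> 0 <= f t) ->
  (forall t : R, 0 < t -> {for t, continuous f}) ->
  (forall t : R, 0 < t -> is_derive t 1 F (f t)) ->
  (forall a b : R, 0 < a -> 0 < b -> F b - F a <= c) ->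
  (\int[leb]_(t in `]0%R, +oo[) (f t)%:E <= c%:E)%E.
Proof.
move=> mf f0 cf dF Fc; rewrite -bigcup_itv_inv_nat.
have k0 k : 0 < k.+1%:R^-1 :> R by rewrite invr_gt0.
pose E k : set (measurableTypeR R) := `[k.+1%:R^-1 : R, k.+2%:R]%classic.
have ndE : nondecreasing_seq E.
  apply/nondecreasing_seqP => k; rewrite subsetEset => t /=.
  rewrite /E /= !in_itv/= => /andP[kt tk]; apply/andP; split.
    by rewrite (le_trans _ kt)// lef_pV2 ?posrE// ler_nat.
  by rewrite (le_trans tk)// ler_nat.
have mE k : measurable (E k) by exact: measurable_itv.
have mfE k : measurable_fun (E k) (EFin \o f).
  by apply: measurable_funTS; exact/measurable_EFinP.
have f0E k t : E k t -> (0 <= (EFin \o f) t)%E.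
  rewrite /E /= in_itv/= => /andP[kt _]; rewrite lee_fin f0//.
  exact: lt_le_trans kt.
have /cvg_lim <-// := ge0_nondecreasing_set_cvg_integral (mu := leb) ndE mE mfE f0E.
apply: lime_le.
  apply: ereal_nondecreasing_is_cvgn.
  exact: ge0_nondecreasing_set_nondecreasing_integral.
apply: nearW => k.
have k12 : k.+1%:R^-1 < k.+2%:R :> R.
  by rewrite (@le_lt_trans _ _ 1)// ?invf_le1// ?ler1n// ltr1n.
have cF t : 0 < t -> {for t, continuous F}.
  move=> t0; apply: differentiable_continuous; apply/derivable1_diffP.
  by have [] := dF _ t0.
rewrite (continuous_FTC2 (F := F))//.
- by rewrite -EFinB lee_fin Fc.
- apply: continuous_in_subspaceT => t; rewrite inE/= in_itv/= => /andP[kt _].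
  by apply: cf; exact: lt_le_trans kt.
- split.
  + move=> t; rewrite in_itv/= => /andP[kt _].
    by have [] := dF _ (lt_trans (k0 k) kt).
  + by apply: cvg_at_right_filter; exact: cF.
  + by apply: cvg_at_left_filter; apply: cF.
- move=> t; rewrite in_itv/= => /andP[kt _].
  by rewrite derive1E; have [] := dF _ (lt_trans (k0 k) kt).
Qed.

(** The [p]-th power of [t / p <= 1 + t / p <= e^(t/p)]. *)
Lemma powR_le_expR (p t : R) : 0 < p -> 0 < t -> t `^ p <= p `^ p * expR t.
Proof.
move=> p0 t0.
have tp : t <= p * expR (t / p).
  rewrite -ler_pdivrMl// mulrC (le_trans _ (expR_ge1Dx _))//.
  by rewrite lerDr.
have -> : expR t = expR (t / p) `^ p by rewrite -expRM divfK ?gt_eqF.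
by rewrite -powRM ?expR_ge0 ?(ltW p0)// ge0_ler_powR ?nnegrE ?mulr_ge0 ?expR_ge0// ltW.
Qed.

(* As [fine +oo = 0], positivity requires the integral to be finite: the integrand is
   at most a constant times the derivative of [- (1 + t^x)^-1], which is bounded. *)
Lemma Gamma_gt0 (x : R) : 0 < x -> 0 < Gamma x.
Proof.
move=> x0; pose h t : R := t `^ (x - 1) * expR (- t).
pose f t : R := x * t `^ (x - 1) / (1 + t `^ x) ^+ 2.
pose F t : R := - (1 + t `^ x)^-1.
have den_gt0 t : 0 < 1 + t `^ x by rewrite ltr_pwDl// powR_ge0.
have mh : measurable_fun setT h.
  by apply: measurable_funM; [|apply: measurableT_comp => //; apply: measurableT_comp].
have mf : measurable_fun setT f.
  apply: measurable_funM; first exact: measurable_funM.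
  rewrite (_ : (fun _ => _) = (fun t : R => (1 + t `^ x) `^ (- 2))).
    by apply: (measurableT_comp (measurable_powR _)); exact: measurable_funD.
  by apply/funext => t; rewrite powRN powR_mulrn// ltW.
have cpow y t : 0 < t -> {for t, continuous (fun t : R => t `^ y)}.
  move=> t0; apply: differentiable_continuous; apply/derivable1_diffP.
  by apply: derivable_powR; rewrite in_itv/= andbT.
have int_f : (\int[leb]_(t in `]0%R, +oo[) (f t)%:E <= 1%:E)%E.
  apply: (@integral_bounded_primitive _ F) => //.
  - by move=> t t0; rewrite /f divr_ge0 ?mulr_ge0 ?powR_ge0 ?sqr_ge0// ltW.
  - move=> t t0; apply: cvgM; first by apply: cvgM; [exact: cvg_cst|exact: cpow].
    apply: cvgV; first by rewrite sqrf_eq0 gt_eqF.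
    rewrite expr2; apply: cvgM; (apply: cvgD; [exact: cvg_cst|exact: cpow]).
  - move=> t t0.
    have -> : f t = - (- (1 + t `^ x) ^- 2 *: (0 + x * t `^ (x - 1))).
      by rewrite /f add0r scaleNr opprK /GRing.scale/= mulrC.
    apply: is_deriveN; apply: is_deriveV; first by rewrite gt_eqF.
    have := is_derive1_powR x t0; exact: is_deriveD.
  - move=> a b a0 b0; rewrite /F opprK addrC.
    rewrite (@le_trans _ _ (1 + a `^ x)^-1)// ?gerDl ?oppr_le0 ?invr_ge0 ?(ltW (den_gt0 _))//.
    by rewrite invf_le1// lerDl powR_ge0.
have [C C0 hC] : exists2 C, 0 < C & forall t, 0 < t -> h t <= C * f t.
  (* By [powR_le_expR], [t^(2x) <= K e^t], so [(1 + t^x)^2 <= 2 + 2 t^(2x) <= (2 + 2K) e^t]; the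
     division by [x] below cancels the factor [x] of [f]. *)
  pose K := (2 * x) `^ (2 * x).
  have K0 : 0 <= K by exact: powR_ge0.
  exists ((2 + 2 * K) / x) => [|t t0].
    by rewrite divr_gt0// ltr_pwDl// mulr_ge0.
  have den : (1 + t `^ x) ^+ 2 <= (2 + 2 * K) * expR t.
    have : (t `^ x) ^+ 2 <= K * expR t.
      rewrite -powR_mulrn ?powR_ge0// -powRrM mulrC powR_le_expR//.
      by rewrite mulr_gt0.
    have := expR_ge1Dx t; have := sqr_ge0 (1 - t `^ x); nra.
  rewrite /h /f expRN.
  have -> : (2 + 2 * K) / x * (x * t `^ (x - 1) / (1 + t `^ x) ^+ 2) =
      t `^ (x - 1) * ((2 + 2 * K) / (1 + t `^ x) ^+ 2).
    by field; rewrite !gt_eqF.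
  rewrite ler_wpM2l ?powR_ge0// ler_pdivlMr ?exprn_gt0// mulrC.
  by rewrite ler_pdivrMr// expR_gt0.
have h0 t : 0 <= h t by rewrite mulr_ge0 ?powR_ge0 ?expR_ge0.
have int_h : (\int[leb]_(t in `]0%R, +oo[) (h t)%:E < +oo)%E.
  apply: (@le_lt_trans _ _ (\int[leb]_(t in `]0%R, +oo[) (C%:E * (f t)%:E))%E).
    apply: ge0_le_integral => //.
    - by move=> t _; rewrite lee_fin.
    - by apply: measurable_funTS; exact/measurable_EFinP.
    - apply: measurable_funTS; apply/measurable_EFinP; exact: measurable_funM.
    - by move=> t /=; rewrite in_itv/= andbT => t0; rewrite -EFinM lee_fin hC.
  rewrite ge0_integralZl ?lee_fin ?(ltW C0)//.
  - by rewrite (@le_lt_trans _ _ (C%:E * 1%:E)%E) ?lee_pmul2l ?lte_fin ?mule1 ?ltry.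
  - by apply: measurable_funTS; exact/measurable_EFinP.
  - move=> t /=; rewrite in_itv/= andbT => t0; rewrite lee_fin.
    by rewrite /f divr_ge0 ?mulr_ge0 ?powR_ge0 ?sqr_ge0// ltW.
rewrite /Gamma /Rintegral fine_gt0// int_h andbT.
(* On [[1, 2]], [t^(x-1) = t^x / t >= 1/2] and [e^-t >= e^-2]. *)
apply: (@lt_le_trans _ _ (\int[leb]_(t in `[1%R, 2%R]) (2^-1 * expR (- 2))%:E)%E).
  rewrite integral_cst//= lebesgue_measure_itv/= lte_fin ltr1n/=.
  by rewrite -EFinB -EFinM lte_fin mulr_gt0 ?mulr_gt0 ?expR_gt0// ; lra.
apply: (@le_trans _ _ (\int[leb]_(t in `[1%R, 2%R]) (h t)%:E)%E).
  apply: ge0_le_integral => //.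
  - by apply: measurable_funTS; exact/measurable_EFinP.
  - move=> t /=; rewrite in_itv/= => /andP[t1 t2]; rewrite lee_fin.
    have t0 : 0 < t by exact: lt_le_trans t1.
    rewrite ler_pM ?expR_ge0// ?ler_expR ?lerN2//.
    have -> : t `^ (x - 1) = t `^ x * t^-1.
      rewrite (@powRD R t x (-1)) ?powR_inv1 ?ltW//.
      by apply/implyP => _; rewrite gt_eqF.
    rewrite -[leLHS]mul1r ler_pM ?lef_pV2 ?posrE//.
    apply: (@le_trans _ _ (1 `^ x)); first by rewrite powR1.
    by rewrite ge0_ler_powR ?nnegrE// ltW.
apply: ge0_subset_integral => //.
- by apply: measurable_funTS; exact/measurable_EFinP.
- by move=> t _; rewrite lee_fin.
- by move=> t /=; rewrite !in_itv/= andbT => /andP[+ _]; exact: lt_le_trans.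
Qed.

End gamma_positive.

(** * Fractional Sobolev spaces *)

Section measurability.
Context (R : realType) (n : nat).

Lemma measurable_box (I : 'I_n -> set (measurableTypeR R)) :
  (forall i, measurable (I i)) ->
  measurable [set x : 'rV[R]_n | forall i, I i (x ord0 i)].
Proof.
move=> mI.
rewrite (_ : [set x | _] = \bigcap_(i in [set: 'I_n]) (rV_coord i @^-1` I i)).
  apply: fin_bigcap_measurable => // i _; rewrite -[X in measurable X]setTI.
  exact: measurable_rV_coord.
by apply/seteqP; split => y /= h i; [move=> _|]; exact: h.
Qed.

Lemma bounded_set_coord (Omega : set 'rV[R]_n) : bounded_set Omega ->
  exists2 M : R, 0 < M & forall x, Omega x -> forall i, `|x ord0 i| < M.
Proof.
move=> bO; have [M1 [_ /(_ (`|M1| + 1))]] := bO.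
rewrite (le_lt_trans (ler_norm _)) ?ltrDl// => /(_ isT) h.
exists (`|M1| + 2); first by rewrite ltr_wpDl.
move=> x Ox i; have : ball (0 : 'rV[R]_n) (`|M1| + 2) x.
  rewrite mx_norm_ball /ball_ /= sub0r normrN (le_lt_trans (h x Ox))//.
  by lra.
by case=> _ /(_ ord0 i); rewrite /ball /= mxE sub0r normrN.
Qed.

(** The sigma-algebra is generated by the coordinates, so an open set is written as a countable
    union of boxes: those with rational centre and half-width [1/(k+1)] that it contains. *)
Lemma open_measurable_rV (A : set 'rV[R]_n) : open A -> measurable A.
Proof.
move=> oA.
pose I (p : 'rV[rat]_n * nat) i : set (measurableTypeR R) :=
  `]ratr (p.1 ord0 i) - p.2.+1%:R^-1, ratr (p.1 ord0 i) + p.2.+1%:R^-1[%classic.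
pose B p : set 'rV[R]_n := [set y | forall i, I p i (y ord0 i)].
have mB p : measurable (B p).
  by apply: (@measurable_box (I p)) => i; exact: measurable_itv.
pose C p := if `[< B p `<=` A >] then B p else set0.
have -> : A = \bigcup_p C p.
  apply/seteqP; split => [x Ax|x [p _]]; last first.
    by rewrite /C; case: asboolP => // BA; exact: BA.
  move: oA; rewrite openE => /(_ _ Ax)/nbhs_ballP[e /= e0 xeA].
  (* A rational centre within [h < e / 2] of [x] gives a box of half-width [h] that contains [x] and
     stays within [2h < e] of it. *)
  have [k ke] : exists k : nat, k.+1%:R^-1 < e / 2.
    have [k _ kP] := near_infty_natSinv_lt (PosNum (divr_gt0 e0 (ltr0n R 2))).
    by exists k; exact: (kP k (leqnn k)).
  have k0 : 0 < k.+1%:R^-1 :> R by rewrite invr_gt0.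
  have q_ex i : exists r : rat, x ord0 i - k.+1%:R^-1 < ratr r < x ord0 i + k.+1%:R^-1.
    have : x ord0 i - k.+1%:R^-1 < x ord0 i + k.+1%:R^-1 by rewrite ltrBlDr -addrA ltrDl addr_gt0.
    by move=> /rat_in_itvoo[r]; rewrite in_itv/=; exists r.
  have [q qP] := choice q_ex.
  move: ke k0 qP; set h := _^-1 => ke k0 qP.
  have Bx : B (\row_i q i, k) x.
    by move=> i; have := qP i; rewrite /I /= !mxE in_itv/= -/h; lra.
  exists (\row_i q i, k) => //; rewrite /C; case: asboolP => // -[] y By.
  apply: xeA; split => // i j; rewrite (ord1 i).
  have := By j; have := qP j; rewrite /I /ball /= !mxE !in_itv/= -/h => h1 h2.
  by rewrite ltr_norml; lra.
apply: countable_bigcupT_measurable => [|p]; first exact: countableP.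
by rewrite /C; case: ifP.
Qed.

Lemma continuous_measurable_rV (v : 'rV[R]_n -> R) :
  continuous v -> measurable_fun setT v.
Proof.
move=> cv; apply: (measurability _ (RGenOpens.measurableE R)) => //.
move=> _ [_ [a [b ->]] <-]; rewrite setTI; apply: open_measurable_rV.
by move/continuousP : cv; apply; exact: interval_open.
Qed.

Lemma measurable_enorm : measurable_fun setT (@enorm R n).
Proof.
apply: (measurableT_comp (continuous_measurable_fun (@sqrt_continuous R))).
by apply: measurable_sum => i; apply: measurable_funX; exact: measurable_rV_coord.
Qed.

Lemma measurable_frac_kernel s : measurable_fun setT (@frac_kernel R n s).
Proof.
rewrite (_ : frac_kernel s =
    (fun p => enorm (p.1 - p.2) `^ (- (n%:R + 2 * s)))); last first.
  by apply/funext => p; rewrite powRN.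
apply: (measurableT_comp (measurable_powR _)).
apply: (measurableT_comp measurable_enorm).
apply: measurable_fun_rVP => i.
rewrite (_ : _ \o _ = (rV_coord i \o fst) \- (rV_coord i \o snd)).
  by apply: measurable_funB; (apply: measurableT_comp; first exact: measurable_rV_coord).
by apply/funext => p; rewrite /= /rV_coord !mxE.
Qed.

Lemma frac_kernel_ge0 s p : 0 <= @frac_kernel R n s p.
Proof. by rewrite invr_ge0 powR_ge0. Qed.

End measurability.

(** * Null sets of the product measure and restriction in L^2 *)

Section ae.
Context d (T : measurableType d) (R : realType).
Variable nu : {sigma_finite_measure set T -> \bar R}.

(** Carries almost everywhere convergence of functions over to their difference quotients [gdiff] on
    the product space. *)
Lemma ae_product (P : T -> Prop) : {ae nu, forall x, P x} ->
  {ae (nu \x nu)%E, forall p : T * T, P p.1 /\ P p.2}.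
Proof.
move=> [N [mN N0 PN]]; exists (N `*` setT `|` setT `*` N); split.
- by apply: measurableU; exact: measurableX.
- apply/eqP; rewrite -measure_le0 (le_trans (measureU2 _ _ _))//=; try exact: measurableX.
  (* The total mass may be infinite; the convention [0 * +oo = 0] is what counts. *)
  have N0' : (nu N * nu setT = 0)%E by rewrite (_ : nu N = 0)// mul0e.
  by rewrite !product_measure1E// [X in (_ + X)%E]muleC !N0' adde0.
- move=> [x y] /= /not_andP[nP|nP]; [left|right]; split => //; exact: PN.
Qed.

Lemma ip_eq0_ae (v : T -> R) : v \in Lfun nu 2%:E -> ip nu v v = 0 ->
  {ae nu, forall x, v x = 0}.
Proof.
move=> v2 v0; have mv := L2_measurable v2.
have /ae_eq_integral_abs : measurable_fun setT (fun x => (v x ^+ 2)%:E).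
  by apply/measurable_EFinP; exact: measurable_funX.
move=> /(_ nu measurableT)[+ _].
under eq_integral do rewrite gee0_abs ?lee_fin ?sqr_ge0//.
rewrite -ip_sqr// v0 => /(_ erefl); apply: filterS => x /(_ I) [] /eqP.
by rewrite sqrf_eq0 => /eqP.
Qed.

Lemma L2_restrict (D : set T) (v : T -> R) : measurable D ->
  v \in Lfun nu 2%:E -> v \_ D \in Lfun nu 2%:E.
Proof.
move=> mD /L2P[mv iv]; apply/L2P; split.
  by apply/(measurable_restrictT _ mD); exact: measurable_funTS.
apply: le_lt_trans iv; apply: ge0_le_integral => //.
- by move=> x _; rewrite lee_fin sqr_ge0.
- apply/measurable_EFinP; apply: measurable_funX.
  by apply/(measurable_restrictT _ mD); exact: measurable_funTS.
- by apply/measurable_EFinP; apply: measurable_funX.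
- move=> x _; rewrite lee_fin patchE; case: ifP => // _.
  by rewrite expr0n sqr_ge0.
Qed.

Lemma ip_restrict_le (D : set T) (v : T -> R) : measurable D ->
  v \in Lfun nu 2%:E -> ip nu (v \_ D) (v \_ D) <= ip nu v v.
Proof.
move=> mD v2; have vD2 := L2_restrict mD v2.
apply: le_Rintegral => //; [exact: L2_integrableM|exact: L2_integrableM|].
move=> x _; rewrite patchE; case: ifP => // _; rewrite mul0r -expr2.
exact: sqr_ge0.
Qed.

End ae.

(** * The Gagliardo form and the closure of the test functions *)

Section sobolev.
Context (R : realType) (n : nat) (s : R).
Notation mu := (lebesgue_rV R n).
Notation mu2 := (mu \x mu)%E.
Implicit Types v w : 'rV[R]_n -> R.

(* The Gagliardo seminorm of [v] is the L^2 norm of [gdiff v] on the product space. *)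
Definition gdiff v (p : 'rV[R]_n * 'rV[R]_n) : R :=
  (v p.1 - v p.2) * Num.sqrt (frac_kernel s p).

Definition energy v w : R := ip mu2 (gdiff v) (gdiff w).

(** The squared H^s norm as a real number, faithful only under [inHs]; see [Hs_normE]. *)
Definition hs_sqr v : R := ip mu v v + energy v v.

Lemma gdiff_lin (c : R) v w :
  gdiff (fun x => c * v x + w x) = fun p => c * gdiff v p + gdiff w p.
Proof. by apply/funext => p; rewrite /gdiff; ring. Qed.

Lemma gdiffB v w : gdiff (fun x => v x - w x) = fun p => gdiff v p - gdiff w p.
Proof. by apply/funext => p; rewrite /gdiff; ring. Qed.

Lemma gdiffM v w p :
  gdiff v p * gdiff w p = (v p.1 - v p.2) * (w p.1 - w p.2) * frac_kernel s p.
Proof.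
rewrite /gdiff -[in RHS](sqr_sqrtr (frac_kernel_ge0 s p)); ring.
Qed.

Lemma gagliardo_sqrE v :
  gagliardo_sqr s v = (\int[mu2]_p (gdiff v p ^+ 2)%:E)%E.
Proof. by apply: eq_integral => p _; rewrite expr2 -(gdiffM v v) expr2. Qed.

Lemma frac_formE v w : frac_form s v w = frac_const n s / 2 * energy v w.
Proof.
by rewrite /frac_form; congr (_ * _); apply: eq_Rintegral => p _; rewrite gdiffM.
Qed.

Lemma measurable_gdiff v : measurable_fun setT v -> measurable_fun setT (gdiff v).
Proof.
move=> mv; apply: measurable_funM.
  by apply: measurable_funB; apply: measurableT_comp.
apply: (measurableT_comp (continuous_measurable_fun (@sqrt_continuous R))).
exact: measurable_frac_kernel.
Qed.

Lemma inHsP v : inHs s v <-> v \in Lfun mu 2%:E /\ gdiff v \in Lfun mu2 2%:E.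
Proof.
rewrite /inHs gagliardo_sqrE; split=> -[v2 gv2]; split=> //.
  by apply/L2P; split => //; apply: measurable_gdiff; exact: L2_measurable v2.
by have [] := (L2P _ _).1 gv2.
Qed.

Lemma inHs_lin (c : R) v w : inHs s v -> inHs s w ->
  inHs s (fun x => c * v x + w x).
Proof.
move=> /inHsP[v2 gv] /inHsP[w2 gw]; apply/inHsP; rewrite gdiff_lin.
by split; exact: L2lin.
Qed.

Lemma energyC v w : energy v w = energy w v.
Proof. exact: ipC. Qed.

Lemma energy_ge0 v : 0 <= energy v v.
Proof. exact: ip_ge0. Qed.

Lemma energy_linl (c : R) u v w : inHs s u -> inHs s v -> inHs s w ->
  energy (fun x => c * u x + v x) w = c * energy u w + energy v w.
Proof.
move=> /inHsP[_ u2] /inHsP[_ v2] /inHsP[_ w2].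
by rewrite /energy gdiff_lin ip_linl.
Qed.

Lemma energyBl u v w :
  inHs s u -> inHs s v -> inHs s w ->
  energy (fun x => u x - v x) w = energy u w - energy v w.
Proof.
by move=> /inHsP[_ u2] /inHsP[_ v2] /inHsP[_ w2]; rewrite /energy gdiffB ipBl.
Qed.

Lemma hs_sqr_ge0 v : 0 <= hs_sqr v.
Proof. by rewrite addr_ge0// ip_ge0. Qed.

Lemma hs_sqr_lin_le (c : R) v w : inHs s v -> inHs s w ->
  hs_sqr (fun x => c * v x + w x) <= 2 * c ^+ 2 * hs_sqr v + 2 * hs_sqr w.
Proof.
move=> /inHsP[v2 gv] /inHsP[w2 gw].
rewrite /hs_sqr /energy gdiff_lin.
have := ip_lin_le c v2 w2; have := ip_lin_le c gv gw; lra.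
Qed.

Lemma Hs_normE v : inHs s v -> Hs_norm s v = (Num.sqrt (hs_sqr v))%:E.
Proof.
move=> /inHsP[v2 gv]; rewrite /Hs_norm Lnorm2_sqr gagliardo_sqrE.
by rewrite -!ip_sqr.
Qed.

(** A finite extended norm already forces both nonnegative summands to be finite. Measurability must
    be supplied, since finiteness of the integrals does not give it. *)
Lemma Hs_norm_lt v (e : R) : measurable_fun setT v -> 0 < e ->
  (Hs_norm s v < e%:E)%E <-> inHs s v /\ hs_sqr v < e ^+ 2.
Proof.
move=> mv e0.
have lt_sqr : inHs s v -> (Hs_norm s v < e%:E)%E <-> hs_sqr v < e ^+ 2.
  move=> Hv; rewrite Hs_normE// lte_fin -[X in _ < X](ger0_norm (ltW e0)).
  by rewrite -sqrtr_sqr ltr_sqrt ?exprn_gt0.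
split=> [ve|[Hv /lt_sqr]]; last exact.
suff Hv : inHs s v by split => //; exact/lt_sqr.
have : ('N[mu]_2%:E[EFin \o v] ^+ 2 + gagliardo_sqr s v < +oo)%E.
  rewrite ltNge leye_eq; apply/negP => /eqP h.
  by move: ve; rewrite /Hs_norm h.
rewrite Lnorm2_sqr gagliardo_sqrE => h.
have i0 : (0 <= \int[mu]_x (v x ^+ 2)%:E)%E.
  by apply: integral_ge0 => x _; rewrite lee_fin sqr_ge0.
have j0 : (0 <= \int[mu2]_p (gdiff v p ^+ 2)%:E)%E.
  by apply: integral_ge0 => x _; rewrite lee_fin sqr_ge0.
apply/inHsP; split; apply/L2P; split => //.
- by apply: le_lt_trans h; rewrite leeDl.
- exact: measurable_gdiff.
- by apply: le_lt_trans h; rewrite leeDr.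
Qed.

Lemma iter_partial_lin (c : R) v w (l : seq 'I_n) : smooth v -> smooth w ->
  iter_partial l (fun x => c * v x + w x) =
  (fun x => c * iter_partial l v x + iter_partial l w x).
Proof.
move=> sv sw; elim: l => [//|i l IH] /=; rewrite IH; apply/funext => x.
have dv := (sv l).2 x i; have dw := (sw l).2 x i.
rewrite (_ : (fun y => _) = c \*: iter_partial l v + iter_partial l w)//.
by rewrite deriveD ?deriveZ//; exact: derivableZ.
Qed.

Lemma smooth_lin (c : R) v w : smooth v -> smooth w ->
  smooth (fun x => c * v x + w x).
Proof.
move=> sv sw l; rewrite iter_partial_lin//; split=> [x|x i].
  apply: (@continuousD _ _ _ (fun y => c * iter_partial l v y)).
    by apply: (@continuousM _ _ (cst c)); [exact: cst_continuous|exact: (sv l).1].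
  exact: (sw l).1.
apply: (@derivableD _ _ _ (c \*: iter_partial l v) (iter_partial l w)).
  by apply: derivableZ; exact: (sv l).2.
exact: (sw l).2.
Qed.

Lemma test_function_lin (Omega : set 'rV[R]_n) (c : R) v w :
  test_function Omega v -> test_function Omega w ->
  test_function Omega (fun x => c * v x + w x).
Proof.
move=> [sv cv vO] [sw cw wO].
have sub : tsupport (fun x => c * v x + w x) `<=` tsupport v `|` tsupport w.
  rewrite /tsupport -closureU; apply: closure_subset => x /=.
  apply: contraPP => /not_orP[/negP/negPn/eqP -> /negP/negPn/eqP ->].
  by rewrite mulr0 addr0 eqxx.
split; first exact: smooth_lin.
- apply: (subclosed_compact _ (compactU cv cw) sub); exact: closed_closure.
- by move=> x /sub[/vO|/wO].
Qed.

Lemma test_function0 (Omega : set 'rV[R]_n) : test_function Omega (fun=> 0).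
Proof.
have it0 l : iter_partial l (fun=> 0 : R) = (fun=> 0 : R) :> ('rV[R]_n -> R).
  elim: l => [//|i l IH] /=; rewrite IH; apply/funext => x.
  exact: derive_cst.
have supp0 : tsupport (fun=> 0 : R) = set0 :> set 'rV[R]_n.
  rewrite /tsupport (_ : [set x | _] = set0) ?closure0//.
  by apply/seteqP; split => x //=; rewrite eqxx.
split; rewrite ?supp0//; last exact: compact0.
by move=> l; rewrite it0; split=> [x|x i]; [exact: cst_continuous|exact: derivable_cst].
Qed.

Lemma test_function_measurable (Omega : set 'rV[R]_n) v :
  test_function Omega v -> measurable_fun setT v.
Proof. by case=> sv _ _; apply: continuous_measurable_rV; exact: (sv [::]).1. Qed.

Lemma inHs0 : inHs s (fun _ : 'rV[R]_n => 0).
Proof.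
apply/inHsP; split; first exact: L20.
rewrite (_ : gdiff _ = fun=> 0); first exact: L20.
by apply/funext => p; rewrite /gdiff subrr mul0r.
Qed.

Lemma tilde_measurable (Omega : set 'rV[R]_n) v :
  in_tildeHs Omega s v -> measurable_fun setT v.
Proof. by move=> [/inHsP[v2 _] _]; exact: L2_measurable v2. Qed.

(** With [tilde_intro], replaces the extended norm below [e] by the real [hs_sqr] below [e], so that
    density arguments become linear arithmetic. *)
Lemma tilde_approx (Omega : set 'rV[R]_n) v (e : R) :
  in_tildeHs Omega s v -> 0 < e ->
  exists phi, [/\ test_function Omega phi, inHs s (fun x => v x - phi x) &
    hs_sqr (fun x => v x - phi x) < e].
Proof.
move=> vt e0; have [Hv /(_ (Num.sqrt e))] := vt.
rewrite sqrtr_gt0 => /(_ e0) [phi tphi].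
have mphi := test_function_measurable tphi.
move/(Hs_norm_lt _ _).1 => [||vphi]; rewrite ?sqrtr_gt0//.
  by apply: measurable_funB => //; exact: tilde_measurable vt.
by rewrite sqr_sqrtr ?ltW// => vphi_e; exists phi.
Qed.

Lemma tilde_intro (Omega : set 'rV[R]_n) v : inHs s v ->
  (forall e : R, 0 < e -> exists phi, [/\ test_function Omega phi,
     inHs s (fun x => v x - phi x) & hs_sqr (fun x => v x - phi x) < e]) ->
  in_tildeHs Omega s v.
Proof.
move=> Hv vapprox; split=> // e e0.
have [phi [tphi Hphi phie]] := vapprox (e ^+ 2) (exprn_gt0 2 e0).
exists phi => //; apply/Hs_norm_lt => //.
apply: measurable_funB; last exact: test_function_measurable tphi.
by move/inHsP : Hv => [v2 _]; exact: L2_measurable v2.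
Qed.

Lemma tilde_lin (Omega : set 'rV[R]_n) (c : R) v w :
  in_tildeHs Omega s v -> in_tildeHs Omega s w ->
  in_tildeHs Omega s (fun x => c * v x + w x).
Proof.
move=> vt wt; apply: tilde_intro => [|e e0]; first exact: inHs_lin vt.1 wt.1.
(* Two errors below [e / K] combine to [(2 c^2 + 2) (e / K) = e / 2]. *)
pose K : R := 4 * (c ^+ 2 + 1).
have K0 : 0 < K by rewrite mulr_gt0// ltr_wpDl ?sqr_ge0.
have [phi [tphi Hphi phie]] := tilde_approx vt (divr_gt0 e0 K0).
have [psi [tpsi Hpsi psie]] := tilde_approx wt (divr_gt0 e0 K0).
exists (fun x => c * phi x + psi x); split; first exact: test_function_lin.
  rewrite (_ : (fun x => _) = fun x => c * (v x - phi x) + (w x - psi x)).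
    exact: inHs_lin.
  by apply/funext => x; ring.
rewrite (_ : (fun x => _) = fun x => c * (v x - phi x) + (w x - psi x)); last first.
  by apply/funext => x; ring.
apply: le_lt_trans (hs_sqr_lin_le _ Hphi Hpsi) _.
apply: (@le_lt_trans _ _ ((2 * c ^+ 2 + 2) * (e / K))).
  rewrite [leRHS]mulrDl lerD//.
    apply: ler_wpM2l; last exact: ltW.
    by apply: mulr_ge0; rewrite ?sqr_ge0.
  by apply: ler_wpM2l; last exact: ltW.
rewrite (_ : _ * _ = e / 2); first by rewrite ltr_pdivrMr// ltr_pMr// ltr1n.
by rewrite /K; field; rewrite gt_eqF// ltr_wpDl ?sqr_ge0.
Qed.

Lemma tilde0 (Omega : set 'rV[R]_n) : in_tildeHs Omega s (fun=> 0).
Proof.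
apply: tilde_intro => [|e e0]; first exact: inHs0.
exists (fun=> 0); under [X in hs_sqr X]eq_fun do rewrite subrr.
under [X in inHs s X]eq_fun do rewrite subrr.
split; [exact: test_function0|exact: inHs0|].
rewrite /hs_sqr /energy (_ : gdiff _ = fun=> 0) ?ip0l ?addr0//.
by apply/funext => p; rewrite /gdiff subrr mul0r.
Qed.

Lemma tildeB (Omega : set 'rV[R]_n) v w :
  in_tildeHs Omega s v -> in_tildeHs Omega s w ->
  in_tildeHs Omega s (fun x => v x - w x).
Proof.
move=> vt wt; have := tilde_lin (-1) wt vt.
by under eq_fun do rewrite mulN1r addrC.
Qed.

(** Test functions vanish off [Omega], so the squared mass of [v] there is a lower bound for every
    approximation error; were it positive, an approximation with smaller error would contradict
    this. *)
Lemma tilde_support (Omega : set 'rV[R]_n) v : measurable Omega ->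
  in_tildeHs Omega s v -> {ae mu, forall x, ~ Omega x -> v x = 0}.
Proof.
move=> mO vt; have /inHsP[v2 _] := vt.1; have mOC := measurableC mO.
have wL2 := L2_restrict mOC v2.
suff w0 : ip mu (v \_ (~` Omega)) (v \_ (~` Omega)) = 0.
  apply: filterS (ip_eq0_ae wL2 w0) => x + Ox.
  by rewrite patchE mem_set.
apply/eqP; rewrite eq_le ip_ge0 andbT leNgt; apply/negP => c0.
have [phi [[_ _ phiO] /inHsP[vphi _] phie]] := tilde_approx vt c0.
have := ip_restrict_le mOC vphi.
have -> : (fun x => v x - phi x) \_ (~` Omega) = v \_ (~` Omega).
  apply/funext => x; rewrite !patchE; case: ifPn => //; rewrite inE => Ox.
  rewrite (_ : phi x = 0) ?subr0//; apply: contra_notP Ox => phix.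
  by apply: phiO; apply: subset_closure; apply/eqP.
move=> h; have := lt_le_trans phie h; rewrite /hs_sqr.
by rewrite ltNge lerDl energy_ge0.
Qed.

End sobolev.

(** * Completeness and the Poincare inequality *)

Section poincare.
Context (R : realType) (n : nat) (s : R).
Notation mu := (lebesgue_rV R n).
Notation mu2 := (mu \x mu)%E.
Implicit Types v w : 'rV[R]_n -> R.

Lemma hs_sqrBC v w :
  hs_sqr s (fun x => v x - w x) = hs_sqr s (fun x => w x - v x).
Proof. by rewrite /hs_sqr /energy !gdiffB ip_sqrBC [in X in _ + X]ip_sqrBC. Qed.

(** The limit is found in L^2 only; its energy is then bounded by Fatou on the product space, where
    [gdiff] converges almost everywhere. *)
Lemma tilde_complete (Omega : set 'rV[R]_n) (v : nat -> 'rV[R]_n -> R) (M : R) :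
  (forall k, in_tildeHs Omega s (v k)) ->
  (forall k m, (k <= m)%N -> hs_sqr s (fun x => v m x - v k x) <= M / 8 ^+ k) ->
  exists2 v0, in_tildeHs Omega s v0 &
    forall k, hs_sqr s (fun x => v k x - v0 x) <= 2 * M / 8 ^+ k.
Proof.
move=> vt vM.
have vH k := (vt k).1; have v2 k := ((inHsP s (v k)).1 (vH k)).1.
have gv2 k := ((inHsP s (v k)).1 (vH k)).2.
have [|v0 [v02 v0cvg v0M]] := @L2_complete _ _ R mu v M v2.
  move=> k m km; apply: le_trans (vM _ _ km).
  by rewrite /hs_sqr lerDl energy_ge0.
have key k : gdiff s (fun x => v0 x - v k x) \in Lfun mu2 2%:E /\
    energy s (fun x => v0 x - v k x) (fun x => v0 x - v k x) <= M / 8 ^+ k.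
  apply: (@L2_fatou _ _ R mu2 (fun m => gdiff s (fun x => v (m + k)%N x - v k x))).
  - by apply: measurable_gdiff; apply: measurable_funB;
      [exact: L2_measurable v02|exact: L2_measurable (v2 k)].
  - by move=> m; rewrite gdiffB; exact: L2B.
  - move=> m; apply: le_trans (vM _ _ (leq_addl m k)).
    by rewrite /hs_sqr lerDr ip_ge0.
  - apply: filterS (ae_product v0cvg) => p [p1 p2].
    have shift t : v m t @[m --> \oo] --> v0 t ->
        v (m + k)%N t - v k t @[m --> \oo] --> v0 t - v k t.
      move=> ct; apply: cvgB; last exact: cvg_cst.
      by rewrite (cvg_shiftn k (v^~ t)).
    apply: cvgM; last exact: cvg_cst.
    by apply: cvgB; exact: shift.
have Hd k : inHs s (fun x => v0 x - v k x).
  by apply/inHsP; split; [exact: L2B|exact: (key k).1].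
(* The L^2 part and the energy part are each at most [M / 8^k], whence the factor [2]. *)
have hsM k : hs_sqr s (fun x => v k x - v0 x) <= 2 * M / 8 ^+ k.
  have := v0M k; rewrite hs_sqrBC /hs_sqr ip_sqrBC; have := (key k).2.
  by rewrite -mulrA; lra.
have v0H : inHs s v0.
  rewrite (_ : v0 = fun x => 1 * (v0 x - v 0%N x) + v 0%N x); first exact: inHs_lin.
  by apply/funext => x; rewrite mul1r subrK.
exists v0 => //; apply: tilde_intro => // e e0.
have e4 : 0 < e / 4 by rewrite divr_gt0.
have [k kP] : exists k, 2 * M / 8 ^+ k < e / 4.
  have /cvgr_lt/(_ _ e4)[k _ kP] := cvg_divX0 (2 * M).
  by exists k; exact: (kP k (leqnn k)).
have [phi [tphi Hphi phie]] := tilde_approx (vt k) e4.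
have phiE : (fun x => v0 x - phi x) = fun x => 1 * (v0 x - v k x) + (v k x - phi x).
  by apply/funext => x; ring.
exists phi; split; rewrite ?phiE//; first exact: inHs_lin.
apply: le_lt_trans (hs_sqr_lin_le 1 (Hd k) Hphi) _.
have := hsM k; rewrite hs_sqrBC; lra.
Qed.

Lemma enorm_coord_bound (x y : 'rV[R]_n) (K : R) : 
  (forall i, `|x ord0 i - y ord0 i| <= K) ->
  enorm (x - y) <= Num.sqrt (n%:R * K ^+ 2).
Proof.
move=> xyK; apply: ler_wsqrtr.
rewrite -[n in leRHS]card_ord -sum1_card natr_sum mulr_suml.
apply: ler_sum => i _; rewrite mul1r !mxE -real_normK ?num_real//.
by rewrite lerXn2r ?nnegrE// (le_trans _ (xyK i)).
Qed.

Lemma enorm_gt0 (x : 'rV[R]_n) i : x ord0 i != 0 -> 0 < enorm x.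
Proof.
move=> xi; rewrite sqrtr_gt0 (bigD1 i)//= ltr_pwDl//.
  by rewrite exprn_even_gt0.
by apply: sumr_ge0 => j _; exact: sqr_ge0.
Qed.

(* The seminorm is bounded below by the integral over [Omega x B], where [B] is a unit
   cube disjoint from [Omega]: there [v y = 0] and the kernel is at least [kappa]. *)
Lemma poincare (Omega : set 'rV[R]_n) : (0 < n)%N -> 0 < s ->
  open Omega -> bounded_set Omega ->
  exists2 P : R, 0 < P & forall v, in_tildeHs Omega s v ->
    ip mu v v <= P * energy s v v.
Proof.
move=> n0 s0 oO bO; have mO := open_measurable_rV oO.
have [M M0 OM] := bounded_set_coord bO.
pose I : set (measurableTypeR R) := `]M, M + 1[%classic.
pose B := [set y : 'rV[R]_n | forall i, I (y ord0 i)].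
have muB : mu B = 1%:E.
  rewrite /B (@lebesgue_rV_box R n (fun=> I)); last by move=> i; exact: measurable_itv.
  rewrite big1// => i _; rewrite /I /= lebesgue_measure_itv/= lte_fin ltrDl ltr01.
  by rewrite -EFinB addrAC subrr add0r.
have mB : measurable B.
  by apply: (@measurable_box _ _ (fun=> I)) => i; exact: measurable_itv.
pose i0 := Ordinal n0.
have BO y : B y -> ~ Omega y.
  move=> /(_ i0); rewrite /I /= in_itv/= => /andP[My _] /OM/(_ i0).
  by rewrite ltNge (le_trans (ltW My) (ler_norm _)).
pose p : R := n%:R + 2 * s.
have p0 : 0 < p by rewrite ltr_wpDl// mulr_gt0.
(* Coordinates lie in []-M, M[] on [Omega] and in []M, M + 1[] on [B], so they differ by at most
   [2M + 1], and [K] bounds the distance. *)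
pose K := Num.sqrt (n%:R * (2 * M + 1) ^+ 2).
have K0 : 0 < K.
  by rewrite sqrtr_gt0 mulr_gt0 ?ltr0n// exprn_gt0// ltr_wpDl// mulr_ge0// ltW.
pose kappa := (K `^ p)^-1.
have kappa0 : 0 < kappa by rewrite invr_gt0 powR_gt0.
have kernel_ge x y : Omega x -> B y -> kappa <= frac_kernel s (x, y).
  move=> Ox By; rewrite /kappa /frac_kernel /= lef_pV2 ?posrE ?powR_gt0//.
    apply: ge0_ler_powR; rewrite ?nnegrE ?sqrtr_ge0 ?(ltW p0)//.
    apply: enorm_coord_bound => i; have := OM _ Ox i; have := By i.
    by rewrite /I /= in_itv/= ltr_norml ler_norml; lra.
  (* Inversion reverses the order only between positive numbers, so the points must differ: their
     coordinates at [i0] lie on either side of [M]. *)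
  apply: (@enorm_gt0 _ i0); rewrite !mxE.
  have := OM _ Ox i0; have := By i0; rewrite /I /= in_itv/= ltr_norml.
  by move=> h1 h2; apply/eqP; lra.
exists kappa^-1 => [|v vt]; first by rewrite invr_gt0.
have /inHsP[v2 gv2] := vt.1.
have mv := L2_measurable v2; have mgv := L2_measurable gv2.
have v_out := tilde_support mO vt.
have mvO : measurable_fun setT (v \_ Omega) := L2_measurable (L2_restrict mO v2).
rewrite ler_pdivlMl// -lee_fin EFinM !ip_sqr//.
rewrite (ae_eq_integral (fun x => ((v \_ Omega) x ^+ 2)%:E))//; last 3 first.
- by apply/measurable_EFinP; exact: measurable_funX.
- by apply/measurable_EFinP; exact: measurable_funX.
- apply: filterS v_out => x vx _; rewrite patchE; case: ifPn => //.
  by move/negP => Ox; rewrite vx// => h; apply: Ox; rewrite inE.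
rewrite -ge0_integralZl//; last 3 first.
- by apply/measurable_EFinP; exact: measurable_funX.
- by move=> x _; rewrite lee_fin sqr_ge0.
- by rewrite lee_fin ltW.
have mF : measurable_fun setT (fun q => (gdiff s v q ^+ 2)%:E).
  by apply/measurable_EFinP; exact: measurable_funX.
have F0 q : (0 <= (gdiff s v q ^+ 2)%:E)%E by rewrite lee_fin sqr_ge0.
rewrite fubini_tonelli1//; apply: ge0_le_integral => //.
- by move=> x _; rewrite -EFinM lee_fin mulr_ge0 ?sqr_ge0// ltW.
- apply/measurable_EFinP; apply: measurable_funM => //; exact: measurable_funX.
- exact: measurable_fun_fubini_tonelli_F.
move=> x _; rewrite /fubini_F.
have mFx : measurable_fun setT (fun y => (gdiff s v (x, y) ^+ 2)%:E).
  exact: (measurableT_comp mF (measurable_pair1 x)).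
apply: (@le_trans _ _ (\int[mu]_(y in B) (gdiff s v (x, y) ^+ 2)%:E)%E); last first.
  exact: ge0_subset_integral.
(* As [mu B = 1], the left-hand side is its own integral over [B]. *)
rewrite -[leLHS]mule1 -muB -integral_cst//.
apply: ae_ge0_le_integral => //.
- by move=> y _; rewrite -EFinM lee_fin mulr_ge0 ?sqr_ge0// ltW.
- exact: measurable_funTS.
apply: filterS v_out => y vy By; rewrite -EFinM lee_fin patchE.
case: ifPn => [|_]; last by rewrite expr0n mulr0 sqr_ge0.
rewrite inE => Ox; rewrite [leRHS]expr2 gdiffM /= vy ?subr0; last exact: BO.
by rewrite -expr2 [leRHS]mulrC ler_wpM2r ?sqr_ge0// kernel_ge.
Qed.

End poincare.

(** * The state equation *)

Section riesz.
Context (R : realType) (n : nat) (s : R) (Omega : set 'rV[R]_n).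
Notation mu := (lebesgue_rV R n).
Notation mu2 := (mu \x mu)%E.
Notation tilde := (in_tildeHs Omega s).
Implicit Types u v w : 'rV[R]_n -> R.

Lemma energy_cvg (x : nat -> 'rV[R]_n -> R) x0 y (M : R) :
  (forall k, inHs s (x k)) -> inHs s x0 -> inHs s y ->
  (forall k, hs_sqr s (fun t => x k t - x0 t) <= M / 8 ^+ k) ->
  energy s (x k) y @[k --> \oo] --> energy s x0 y /\
  energy s (x k) (x k) @[k --> \oo] --> energy s x0 x0.
Proof.
move=> xH x0H yH xM.
have x2 k := ((inHsP s (x k)).1 (xH k)).2.
have x02 := ((inHsP s x0).1 x0H).2.
have y2 := ((inHsP s y).1 yH).2.
have cx : ip mu2 (fun p => gdiff s (x k) p - gdiff s x0 p)
    (fun p => gdiff s (x k) p - gdiff s x0 p) @[k --> \oo] --> (0 : R).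
  apply: (@cvg0_squeeze _ M) => k; rewrite ip_ge0 -gdiffB /=.
  by apply: le_trans (xM k); rewrite lerDr ip_ge0.
split; apply: ip_cvg => //.
under eq_fun do under eq_fun do rewrite subrr.
by under eq_fun do rewrite ip0l; exact: cvg_cst.
Qed.

Lemma energy_mid v w : inHs s v -> inHs s w ->
  let m := fun x => 2^-1 * (v x - w x) + w x in
  energy s m m + 4^-1 * energy s (fun x => v x - w x) (fun x => v x - w x) =
  (energy s v v + energy s w w) / 2.
Proof.
move=> /inHsP[_ gv] /inHsP[_ gw] m; rewrite -(ip_mid gv gw)/= /energy gdiffB.
suff -> : gdiff s m = fun p => 2^-1 * (gdiff s v p - gdiff s w p) + gdiff s w p by [].
by apply/funext => p; rewrite /m /gdiff; ring.
Qed.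

(** Riesz representation for the scalar product [kappa * energy]. Completeness is available for
    [hs_sqr]; the Poincare constant [P] makes the energy control it. *)
Lemma tilde_riesz (P kappa M : R) (F : ('rV[R]_n -> R) -> R) :
  0 < P -> (forall v, tilde v -> ip mu v v <= P * energy s v v) ->
  0 < kappa -> 0 < M ->
  (forall (c : R) v w, tilde v -> tilde w ->
     F (fun x => c * v x + w x) = c * F v + F w) ->
  (forall v, tilde v -> F v ^+ 2 <= M * energy s v v) ->
  exists2 u, tilde u & forall v, tilde v -> kappa * energy s u v = F v.
Proof.
move=> P0 poinc kappa0 M0 Flin FM.
have FB v w : tilde v -> tilde w -> F (fun x => v x - w x) = F v - F w.
  move=> vt wt; have := Flin (-1) w v wt vt.
  under eq_fun do rewrite mulN1r addrC.
  by move=> ->; rewrite mulN1r addrC.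
have Esqr (c : R) v w : tilde v -> tilde w ->
    energy s (fun x => c * v x + w x) (fun x => c * v x + w x) =
    c ^+ 2 * energy s v v + 2 * c * energy s v w + energy s w w.
  move=> [/inHsP[_ gv] _] [/inHsP[_ gw] _].
  by rewrite /energy gdiff_lin ip_sqrD.
pose I v := kappa / 2 * energy s v v - F v.
(* The linear part of [I] has no gap, and the parallelogram identity leaves [1/4] of [kappa / 2]. *)
pose q v w := kappa / 8 * energy s (fun x => v x - w x) (fun x => v x - w x).
have [u ut umin] : exists2 u, tilde u & forall v, tilde v -> I u <= I v.
  apply: (@minimizer_exists _ _ tilde I q (- (M / (2 * kappa)))).
  - by exists (fun=> 0); exact: tilde0.
  - move=> v vt; rewrite /I -subr_ge0 opprK.
    (* Multiplied by [2 kappa M], the difference is at least [(kappa F v - M)^2], by the bound on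
       [F v ^ 2]. *)
    rewrite -(pmulr_lge0 _ (_ : 0 < 2 * kappa * M)); last by rewrite !mulr_gt0.
    rewrite [leRHS](_ : _ = kappa ^+ 2 * (M * energy s v v) - 2 * kappa * M * F v + M ^+ 2).
      have := FM v vt; have := sqr_ge0 (kappa * F v - M).
      have : 0 <= kappa ^+ 2 by exact: sqr_ge0.
      by nra.
    by field; rewrite gt_eqF.
  - move=> v w vt wt; have vwt := tildeB vt wt.
    exists (fun x => 2^-1 * (v x - w x) + w x); first exact: tilde_lin.
    rewrite /I /q Flin// FB//.
    have /= := energy_mid vt.1 wt.1.
    set e1 := energy _ _ _; set e2 := energy _ _ _; set e3 := energy _ _ _.
    set e4 := energy _ _ _ => e1E.
    have -> : e1 = (e3 + e4) / 2 - 4^-1 * e2 by rewrite -e1E; ring.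
    by rewrite le_eqVlt; apply/orP; left; apply/eqP; field.
  - move=> x xt xq.
    (* The bound on [q] gives energy at most [(8 / kappa) / 8^k]; the L^2 part adds at most [P]
       times as much. *)
    have [|u ut uM] := @tilde_complete _ _ s Omega x ((P + 1) * (8 / kappa)) xt.
      move=> k m km; have := xq k m km; rewrite /q.
      rewrite /hs_sqr; have := poinc _ (tildeB (xt m) (xt k)).
      set e := energy _ _ _; set i := ip _ _ _ => ie qe.
      have ee : e <= 8 / kappa / 8 ^+ k.
        have -> : e = 8 / kappa * (kappa / 8 * e) by field; rewrite gt_eqF.
        by rewrite div1r in qe; apply: ler_wpM2l => //; rewrite divr_ge0// ltW.
      rewrite -mulrA; apply: (@le_trans _ _ ((P + 1) * e)); first by lra.
      by apply: ler_wpM2l => //; rewrite addr_ge0// ltW.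
    exists u => //; have [_ Ecvg] := energy_cvg (fun k => (xt k).1) ut.1 ut.1 uM.
    apply: cvgB; first by apply: cvgM; [exact: cvg_cst|exact: Ecvg].
    apply/subr_cvg0.
    have sq0 : (F (x k) - F u) ^+ 2 @[k --> \oo] --> (0 : R).
      apply: (@cvg0_squeeze _ (M * (2 * ((P + 1) * (8 / kappa))))) => k.
      rewrite sqr_ge0 -FB//=; apply: le_trans (FM _ (tildeB (xt k) ut)) _.
      rewrite -[leRHS]mulrA; apply: ler_wpM2l; first exact: ltW.
      by apply: le_trans (uM k); rewrite /hs_sqr lerDr ip_ge0.
    have := cvg_sqrt0 sq0; under eq_fun do rewrite sqrtr_sqr.
    exact: norm_cvg0.
exists u => // v vt; apply/eqP; rewrite -subr_eq0; apply/eqP.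
(* [I (u + t v) - I u] is a nonnegative quadratic in [t] without constant term, so its linear
   coefficient vanishes. *)
suff : ((kappa * energy s u v - F v) / 2) ^+ 2 <= 0 * (kappa / 2 * energy s v v).
  rewrite mul0r => h; apply/eqP.
  have : ((kappa * energy s u v - F v) / 2) ^+ 2 == 0 by rewrite eq_le h sqr_ge0.
  by rewrite sqrf_eq0 mulf_eq0 invr_eq0 pnatr_eq0 orbF.
apply: quadratic_discriminant.
  by rewrite mulr_ge0 ?energy_ge0// divr_ge0// ltW.
move=> t; have := umin _ (tilde_lin t vt ut).
rewrite /I Esqr// Flin// (energyC s v u) => h.
rewrite -(subr_ge0) in h; rewrite (le_trans h)//.
by rewrite le_eqVlt; apply/orP; left; apply/eqP; field.
Qed.

End riesz.

Section control.
Context (R : realType) (n : nat) (Omega : set 'rV[R]_n) (s : R).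
Context (f : ('rV[R]_n -> R) -> R) (P : R).
Context (s01 : 0 < s < 1) (P0 : 0 < P).
Context (poinc : forall v, in_tildeHs Omega s v ->
  ip (lebesgue_rV R n) v v <= P * energy s v v).
Context (hf : in_dual Omega s f).
Notation mu := (lebesgue_rV R n).
Notation tilde := (in_tildeHs Omega s).
Notation kappa := (frac_const n s / 2).
Implicit Types u v w z : 'rV[R]_n -> R.

Lemma frac_const_gt0 : 0 < frac_const n s :> R.
Proof.
have [s0 s1] := andP s01.
have G1 : 0 < Gamma (s + n%:R / 2).
  by apply: Gamma_gt0; rewrite ltr_wpDr// divr_ge0.
have G2 : 0 < Gamma (1 - s) by apply: Gamma_gt0; rewrite subr_gt0.
apply: divr_gt0; apply: mulr_gt0 => //; last by rewrite powR_gt0// pi_gt0.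
by rewrite mulr_gt0// powR_gt0.
Qed.

Lemma kappa_gt0 : 0 < kappa :> R.
Proof. by rewrite divr_gt0// frac_const_gt0. Qed.

Lemma Rintegral_control z v :
  (\int[mu]_(x in Omega) (z x * v x))%R = ip mu (z \_ Omega) v.
Proof.
rewrite Rintegral_mkcond; apply: eq_Rintegral => x _.
by rewrite !patchE; case: ifP => // _; rewrite mul0r.
Qed.

Lemma state_equationE u z : state_equation Omega s f u z <->
  forall v, tilde v -> kappa * energy s u v = f v + ip mu (z \_ Omega) v.
Proof.
by split=> h v /h; rewrite frac_formE Rintegral_control.
Qed.

Lemma L2norm_sqr v : inL2 Omega v ->
  L2norm Omega v ^+ 2 = ip mu (v \_ Omega) (v \_ Omega).
Proof.
move=> v2; have : ('N[mu]_2%:E[EFin \o (v \_ Omega)] < +oo)%E.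
  by move: v2; rewrite /inL2 inE => /andP[_ /[!inE]].
rewrite -ge0_fin_numE ?Lnorm_ge0// => Nfin.
apply/EFin_inj; rewrite ip_sqr// -Lnorm2_sqr /L2norm.
by rewrite EFin_expe fineK.
Qed.

Lemma state_exists z : inL2 Omega z ->
  exists2 u, tilde u & state_equation Omega s f u z.
Proof.
move=> z2; have [flin [C fC]] := hf.
pose F v := f v + ip mu (z \_ Omega) v.
have t2 v : tilde v -> v \in Lfun mu 2%:E by move=> [/inHsP[]].
pose zz := ip mu (z \_ Omega) (z \_ Omega).
have zz0 : 0 <= zz by exact: ip_ge0.
(* From [(x + y)^2 <= 2 x^2 + 2 y^2]: the square of [f v] is at most [C^2 (P + 1)] energies, that of
   the control term at most [zz P]. The [1] makes [M] positive. *)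
pose M := 2 * C ^+ 2 * (P + 1) + 2 * zz * P + 1.
have M0 : 0 < M.
  have C0 : 0 <= C ^+ 2 := sqr_ge0 C.
  rewrite ltr_wpDl// addr_ge0//; apply: mulr_ge0; rewrite ?(ltW P0)//.
  - exact: mulr_ge0.
  - by rewrite addr_ge0// ltW.
  - exact: mulr_ge0.
have [|v vt|u ut uF] := tilde_riesz P0 poinc kappa_gt0 M0 (F := F).
- move=> c v w vt wt; rewrite /F flin// (ipC _ (z \_ Omega)).
  by rewrite (ip_linl c (t2 _ vt) (t2 _ wt) z2) !(ipC mu _ (z \_ Omega)); ring.
- have fv : f v ^+ 2 <= C ^+ 2 * hs_sqr s v.
    have := fC v vt; rewrite (Hs_normE vt.1) -EFinM lee_fin => h.
    have := lerXn2r 2 _ _ h; rewrite real_normK ?num_real// exprMn.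
    rewrite sqr_sqrtr ?hs_sqr_ge0//; apply; rewrite ?nnegrE//.
    exact: le_trans h.
  have zv : ip mu (z \_ Omega) v ^+ 2 <= zz * ip mu v v.
    exact: cauchy_schwarz z2 (t2 _ vt).
  have hsP : hs_sqr s v <= (P + 1) * energy s v v.
    by have := poinc vt; rewrite /hs_sqr; lra.
  have E0 := energy_ge0 s v.
  have := sqr_ge0 (f v - ip mu (z \_ Omega) v).
  have := ler_wpM2l (sqr_ge0 C) hsP; have := ler_wpM2l zz0 (poinc vt).
  rewrite /M /F; nra.
by exists u => //; exact/state_equationE.
Qed.

(* Testing the difference of the two equations with [u - u']. *)
Lemma state_difference u z u' z' : tilde u -> tilde u' ->
  inL2 Omega z -> inL2 Omega z' ->
  state_equation Omega s f u z -> state_equation Omega s f u' z' ->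
  energy s (fun x => u x - u' x) (fun x => u x - u' x) <= P / kappa ^+ 2 *
    ip mu (fun x => (z \_ Omega) x - (z' \_ Omega) x)
          (fun x => (z \_ Omega) x - (z' \_ Omega) x).
Proof.
move=> ut u't z2 z'2 h1 h2.
set du := fun x => u x - u' x; set dz := fun x => (z \_ Omega) x - _.
have eq1 := (state_equationE u z).1 h1; have eq2 := (state_equationE u' z').1 h2.
have dut : tilde du by exact: tildeB.
have du2 := ((inHsP s du).1 dut.1).1.
have k0 := kappa_gt0.
have E0 := energy_ge0 s du.
have eqd : kappa * energy s du du = ip mu dz du.
  rewrite (energyBl ut.1 u't.1 dut.1).
  by rewrite mulrBr eq1// eq2// /dz ipBl//; ring.
have : (kappa * energy s du du) ^+ 2 <= ip mu dz dz * (P * energy s du du).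
  rewrite eqd; apply: le_trans (cauchy_schwarz (L2B z2 z'2) du2) _.
  by apply: ler_wpM2l; [exact: ip_ge0|exact: poinc].
(* The estimate is quadratic in the energy on the left and linear on the right; cancelling one
   factor requires it to be nonzero. *)
move: E0; rewrite le_eqVlt => /predU1P[<- _|E0].
  by rewrite mulr_ge0 ?ip_ge0// divr_ge0 ?sqr_ge0// ltW.
move=> h; rewrite [leRHS]mulrAC ler_pdivlMr ?exprn_gt0// -(ler_pM2r E0).
have -> : energy s du du * kappa ^+ 2 * energy s du du =
  (kappa * energy s du du) ^+ 2 by ring.
by apply: le_trans h _; rewrite mulrCA mulrA.
Qed.

(** * The control problem *)

Context (ud : 'rV[R]_n -> R) (a b alpha : R).
Context (mO : measurable Omega) (alpha0 : 0 < alpha) (hud : inL2 Omega ud).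

(** The tracking error extended by zero, so that the cost becomes a sum of [ip] terms over R^n. *)
Definition uerr u x := (u \_ Omega) x - (ud \_ Omega) x.

Lemma uerr_L2 u : tilde u -> uerr u \in Lfun mu 2%:E.
Proof. by move=> [/inHsP[u2 _] _]; apply: L2B => //; exact: L2_restrict. Qed.

Lemma uerrB u v :
  (fun x => uerr u x - uerr v x) = (fun x => u x - v x) \_ Omega.
Proof.
apply/funext => x; rewrite /uerr !patchE; case: ifPn => _; last by rewrite subrr.
by ring.
Qed.

Lemma costE u z : tilde u -> inL2 Omega z -> cost Omega alpha ud u z =
  2^-1 * ip mu (uerr u) (uerr u) + alpha / 2 * ip mu (z \_ Omega) (z \_ Omega).
Proof.
move=> ut z2; have uE : (u \- ud) \_ Omega = uerr u.
  by apply/funext => x; rewrite /uerr !patchE; case: ifP; rewrite ?subr0.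
rewrite /cost !L2norm_sqr ?uE// /inL2 uE; exact: uerr_L2.
Qed.

(* The midpoint convexity gap of the cost. *)
Definition pair_dist (p p' : ('rV[R]_n -> R) * ('rV[R]_n -> R)) : R :=
  let du := fun x => uerr p.1 x - uerr p'.1 x in
  let dz := fun x => (p.2 \_ Omega) x - (p'.2 \_ Omega) x in
  8^-1 * ip mu du du + alpha / 8 * ip mu dz dz.

Definition mid v w x : R := 2^-1 * (v x - w x) + w x.

(** The bounds on the control are convex and the state equation is affine in the pair. The gap is an
    equality, by the parallelogram identity in each term. *)
Lemma feasible_mid u z u' z' :
  feasible Omega s a b f u z -> feasible Omega s a b f u' z' ->
  feasible Omega s a b f (mid u u') (mid z z') /\
  cost Omega alpha ud (mid u u') (mid z z') + pair_dist (u, z) (u', z') =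
  (cost Omega alpha ud u z + cost Omega alpha ud u' z') / 2.
Proof.
move=> [ut [z2 zab] eq1] [u't [z'2 z'ab] eq2].
have mt : tilde (mid u u') by apply: tilde_lin => //; exact: tildeB.
have zE : (mid z z') \_ Omega =
    fun x => 2^-1 * ((z \_ Omega) x - (z' \_ Omega) x) + (z' \_ Omega) x.
  apply/funext => x; rewrite /mid !patchE; case: ifP => // _.
  by rewrite subrr mulr0 addr0.
have m2 : inL2 Omega (mid z z') by rewrite /inL2 zE; apply: L2lin => //; exact: L2B.
split.
  split=> //; first split=> //.
    apply: filterS2 zab z'ab => x + + Ox => /(_ Ox)/andP[az zb] /(_ Ox)/andP[az' z'b].
    by rewrite /mid; apply/andP; split; lra.
  apply/state_equationE => v vt; rewrite zE.
  have /inHsP[v2 _] := vt.1.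
  rewrite ip_linl ?L2B// ipBl// energy_linl ?vt.1 ?u't.1//; last first.
  - exact: vt.1.
  - exact: u't.1.
  - exact: (tildeB ut u't).1.
  rewrite (energyBl ut.1 u't.1 vt.1).
  have e1 := (state_equationE u z).1 eq1 v vt.
  have e2 := (state_equationE u' z').1 eq2 v vt.
  by rewrite mulrDr mulrCA mulrBr e1 e2; field.
rewrite !costE// /pair_dist /=.
have uE : uerr (mid u u') = fun x => 2^-1 * (uerr u x - uerr u' x) + uerr u' x.
  apply/funext => x; rewrite /uerr /mid !patchE.
  by case: ifP => _; field.
have := ip_mid (uerr_L2 ut) (uerr_L2 u't); rewrite /= -uE.
have /(congr1 ( *%R alpha)) := ip_mid z2 z'2; rewrite /= -zE; lra.
Qed.

(** [pair_dist] measures the states only in L^2 of [Omega], too weak for a limit in the energy. Its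
    state term is dropped, and the states are controlled through the controls by
    [state_difference]. *)
Lemma feasible_complete (p : nat -> ('rV[R]_n -> R) * ('rV[R]_n -> R)) :
  (forall k, feasible Omega s a b f (p k).1 (p k).2) ->
  (forall k m, (k <= m)%N -> pair_dist (p m) (p k) <= 1 / 8 ^+ k) ->
  exists u z, feasible Omega s a b f u z /\
    cost Omega alpha ud (p k).1 (p k).2 @[k --> \oo] --> cost Omega alpha ud u z.
Proof.
move=> pF pd; pose zO k := (p k).2 \_ Omega.
have ut k : tilde (p k).1 by have [] := pF k.
have z2 k : inL2 Omega (p k).2 by have [_ []] := pF k.
have zM k m : (k <= m)%N -> ip mu (fun x => zO m x - zO k x)
    (fun x => zO m x - zO k x) <= (8 / alpha) / 8 ^+ k.
  move=> km; have := pd k m km; rewrite /pair_dist div1r.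
  set i1 := ip _ _ _; set i2 := ip _ _ _ => h.
  have i10 : 0 <= i1 by exact: ip_ge0.
  have -> : i2 = 8 / alpha * (alpha / 8 * i2) by field; rewrite gt_eqF.
  by apply: ler_wpM2l; [rewrite divr_ge0// ltW|lra].
have [z0 [z02 z0cvg z0M]] := L2_complete z2 zM.
(* [8 / alpha] undoes the weight of the controls in [pair_dist], [P / kappa^2] is the stability
   constant of the state equation, and [P + 1] passes from the energy to [hs_sqr]. *)
pose Mu := (P + 1) * (P / kappa ^+ 2 * (8 / alpha)).
have [|u0 u0t u0M] := @tilde_complete _ _ s Omega (fun k => (p k).1) Mu ut.
  move=> k m km; have [_ _ eqm] := pF m; have [_ _ eqk] := pF k.
  have Ele := state_difference (ut m) (ut k) (z2 m) (z2 k) eqm eqk.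
  have hle : hs_sqr s (fun x => (p m).1 x - (p k).1 x) <= (P + 1) *
      energy s (fun x => (p m).1 x - (p k).1 x) (fun x => (p m).1 x - (p k).1 x).
    by have := poinc (tildeB (ut m) (ut k)); rewrite /hs_sqr; lra.
  apply: le_trans hle _; rewrite /Mu -mulrA; apply: ler_wpM2l.
    by rewrite addr_ge0// ltW.
  apply: le_trans Ele _; rewrite -[leRHS]mulrA; apply: ler_wpM2l; last exact: zM.
  by rewrite divr_ge0 ?sqr_ge0// ltW.
have z0O2 : inL2 Omega z0 by exact: L2_restrict.
(* [zO k] vanishes off [Omega], so cutting the difference off there turns [z0] into its restriction
   and does not increase the distance. *)
have zOM k : 0 <= ip mu (fun x => zO k x - (z0 \_ Omega) x)
    (fun x => zO k x - (z0 \_ Omega) x) <= (8 / alpha) / 8 ^+ k.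
  rewrite ip_ge0/=; apply: le_trans (z0M k).
  apply: le_trans (ip_restrict_le mO (L2B (z2 k) z02)).
  rewrite le_eqVlt; apply/orP; left; apply/eqP; apply: eq_Rintegral => x _.
  by rewrite /zO !patchE; case: ifP => //; rewrite subr0.
have zcvg := cvg0_squeeze zOM.
have u0O2 : u0 \_ Omega \in Lfun mu 2%:E.
  by apply: L2_restrict => //; have /inHsP[] := u0t.1.
have ucvg : ip mu (fun x => uerr (p k).1 x - uerr u0 x)
    (fun x => uerr (p k).1 x - uerr u0 x) @[k --> \oo] --> (0 : R).
  apply: (@cvg0_squeeze _ (2 * Mu)) => k; rewrite ip_ge0/=.
  have d2 := ((inHsP s _).1 (tildeB (ut k) u0t).1).1.
  apply: le_trans (u0M k); rewrite /hs_sqr.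
  apply: (@le_trans _ _ (ip mu (fun x => (p k).1 x - u0 x) (fun x => (p k).1 x - u0 x))).
    apply: le_trans (ip_restrict_le mO d2).
    by rewrite uerrB.
  by rewrite lerDl energy_ge0.
exists u0, z0; split.
  split=> //; first split=> //.
    have zab k : {ae mu, forall x, Omega x -> a <= (p k).2 x <= b}.
      by have [_ [_ ]] := pF k.
    (* Countably many exceptional sets merge into one, and the closed bounds pass to the pointwise
       limit. *)
    apply: filterS2 (ae_foralln zab) z0cvg => x xab xcvg Ox.
    have {}xcvg : (p k).2 x @[k --> \oo] --> z0 x.
      by move: xcvg; under eq_fun do rewrite /zO patchE mem_set//.
    apply/andP; split.
      by apply: (ler_cvg_to (cvg_cst a) xcvg); apply: nearW => k; have /andP[] := xab k Ox.
    by apply: (ler_cvg_to xcvg (cvg_cst b)); apply: nearW => k; have /andP[] := xab k Ox.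
  apply/state_equationE => v vt.
  have /inHsP[v2 _] := vt.1.
  have [Ecvg _] := energy_cvg (fun k => (ut k).1) u0t.1 vt.1 u0M.
  have rcvg : f v + ip mu (zO k) v @[k --> \oo] --> f v + ip mu (z0 \_ Omega) v.
    apply: cvgD; first exact: cvg_cst.
    apply: ip_cvg => //.
    by under eq_fun do under eq_fun do rewrite subrr;
      under eq_fun do rewrite ip0l; exact: cvg_cst.
  have lcvg : kappa * energy s (p k).1 v @[k --> \oo] --> kappa * energy s u0 v.
    by apply: cvgM; [exact: cvg_cst|exact: Ecvg].
  apply: (cvg_unique _ lcvg) => //; move: rcvg; apply: cvg_trans.
  apply: near_eq_cvg; apply: nearW => k.
  by have [_ _ /state_equationE ->] := pF k.
rewrite costE//; under eq_fun do rewrite costE//.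
apply: cvgD; (apply: cvgM; [exact: cvg_cst|]).
  by apply: ip_cvg => // [k|k||]; exact: uerr_L2.
exact: ip_cvg.
Qed.

Lemma optimal_pair_exists : (exists u z, feasible Omega s a b f u z) ->
  exists u z, optimal_pair Omega s alpha a b f ud u z.
Proof.
move=> [u0 [z0 uz0]].
pose K : set (('rV[R]_n -> R) * ('rV[R]_n -> R)) :=
  [set p | feasible Omega s a b f p.1 p.2].
have [||||[u z] uz uzmin] := @minimizer_exists R _ K
  (fun p => cost Omega alpha ud p.1 p.2) pair_dist 0.
- by exists (u0, z0).
- move=> p _; rewrite /cost addr_ge0// mulr_ge0 ?sqr_ge0// ?divr_ge0//.
  exact: ltW.
- move=> [u z] [u' z'] uz uz'; have [mF mcost] := feasible_mid uz uz'.
  by exists (mid u u', mid z z') => //=; rewrite mcost.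
- move=> p pF pd; have [u [z [uzF uzcvg]]] := feasible_complete pF pd.
  by exists (u, z).
by exists u, z; split => // u' z' uz'; exact: (uzmin (u', z')).
Qed.

Lemma optimal_pair_unique u z u' z' :
  optimal_pair Omega s alpha a b f ud u z ->
  optimal_pair Omega s alpha a b f ud u' z' ->
  u' = u %[ae mu] /\ z' = z %[ae mu in Omega].
Proof.
move=> [uz uzmin] [uz' uzmin'].
have [mF mcost] := feasible_mid uz' uz.
have m1 := uzmin _ _ mF; have m2 := uzmin' _ _ mF.
have [ut [z2 _] _] := uz; have [u't [z'2 _] _] := uz'.
have [/inHsP[uL2 _] _] := ut; have [/inHsP[u'L2 _] _] := u't.
have du2 := L2B (uerr_L2 u't) (uerr_L2 ut); have dz2 := L2B z'2 z2.
(* The midpoint costs at least as much as either optimal pair, so the gap in [mcost] cannot be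
   positive. *)
have : pair_dist (u', z') (u, z) <= 0 by lra.
rewrite /pair_dist /=.
have i10 := ip_ge0 mu (fun x => uerr u' x - uerr u x).
have i20 := ip_ge0 mu (fun x => (z' \_ Omega) x - (z \_ Omega) x).
set i1 := ip _ _ _ in i10 *; set i2 := ip _ _ _ in i20 * => i12.
have i11 : i1 = 0 by have := mulr_ge0 (ltW alpha0) i20; lra.
have i22 : i2 = 0.
  apply/eqP; rewrite eq_le i20 andbT -(pmulr_rle0 _ alpha0); lra.
split.
  apply: filterS3 (ip_eq0_ae du2 i11) (tilde_support mO ut)
    (tilde_support mO u't) => x ex ux u'x _.
  have [Ox|Ox] := pselect (Omega x); last by rewrite ux// u'x.
  by move: ex; rewrite /uerr !patchE mem_set// opprB addrA subrK => /subr0_eq.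
apply: filterS (ip_eq0_ae dz2 i22) => x + Ox.
by rewrite !patchE mem_set// => /subr0_eq.
Qed.

End control.

(** * Constant controls on a bounded set *)

Section finite_measure_bounded.
Context (R : realType) (n : nat).
Notation mu := (lebesgue_rV R n).

Lemma bounded_lebesgue_lty (Omega : set 'rV[R]_n) :
  measurable Omega -> bounded_set Omega -> (mu Omega < +oo)%E.
Proof.
move=> mO bO.
have [M M0 OM] := bounded_set_coord bO.
pose I : set (measurableTypeR R) := `]-M, M[%classic.
have mB : measurable [set x : 'rV[R]_n | forall i, I (x ord0 i)].
  by apply: (@measurable_box _ _ (fun=> I)) => i; exact: measurable_itv.
apply: (@le_lt_trans _ _ (mu [set x | forall i, I (x ord0 i)])).
  apply: le_measure; rewrite ?inE// => x Ox i.
  by rewrite /I /= in_itv/= -ltr_norml; exact: OM.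
rewrite (@lebesgue_rV_box R n (fun=> I)) => [|i]; last exact: measurable_itv.
rewrite (eq_bigr (fun=> (2 * M)%:E)) => [|i _].
  by rewrite prodEFin ltry.
rewrite /I lebesgue_measure_itv/= lte_fin.
by rewrite ifT ?gtrN// opprK -EFinD; congr _%:E; ring.
Qed.

(** Makes the constant [a] an admissible control, from which the first feasible pair is built. *)
Lemma inL2_cst (Omega : set 'rV[R]_n) (c : R) :
  measurable Omega -> bounded_set Omega -> inL2 Omega (fun=> c).
Proof.
move=> mO bO; apply/L2P; split.
  by apply/(measurable_restrictT _ mO); exact: measurable_cst.
rewrite (_ : (\int[mu]_x _ = \int[mu]_(x in Omega) (c ^+ 2)%:E)%E).
  by rewrite integral_cst// lte_mul_pinfty ?lee_fin ?sqr_ge0//; exact: bounded_lebesgue_lty.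
rewrite [RHS]integral_mkcond; apply: eq_integral => x _.
by rewrite !patchE; case: ifP => // _; rewrite expr0n.
Qed.

End finite_measure_bounded.

Theorem theorem1 (R : realType) (n : nat) (Omega : set 'rV[R]_n)
  (s alpha a b : R) (f : ('rV[R]_n -> R) -> R) (ud : 'rV[R]_n -> R)
  (hn : (1 <= n)%N)
  (hOmega : bounded_domain Omega)
  (hLip : lipschitz_boundary Omega)
  (hball : exterior_ball_condition Omega)
  (hs : 0 < s < 1)
  (halpha : 0 < alpha)
  (hab : a < b)
  (hf : in_dual Omega s f)
  (hud : inL2 Omega ud) :
  exists ubar zbar : 'rV[R]_n -> R,
    optimal_pair Omega s alpha a b f ud ubar zbar /\
    forall u z : 'rV[R]_n -> R, optimal_pair Omega s alpha a b f ud u z ->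
      u = ubar %[ae lebesgue_rV R n] /\
      z = zbar %[ae lebesgue_rV R n in Omega].
Proof.
have [oO _ _ bO] := hOmega; have mO := open_measurable_rV oO.
have [s0 _] := andP hs.
have [P P0 poinc] := poincare hn s0 oO bO.
have a2 : inL2 Omega (fun=> a) by exact: inL2_cst.
have [u0 u0t u0eq] := state_exists hs P0 poinc hf a2.
have feas : exists u z, feasible Omega s a b f u z.
  exists u0, (fun=> a); split=> //; split=> //.
  by apply: nearW => x _; rewrite lexx ltW.
have [u [z uz]] := optimal_pair_exists hs P0 poinc mO halpha hud feas.
exists u, z; split=> // u' z' uz'.
exact: (optimal_pair_unique mO halpha hud uz uz').
Qed.
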